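(* Let $\mathcal{A}$ be a strongly connected $d$-dimensional VASS MDP, let $(\mathbf{y},\mathbf{z})$ be a maximal solution of constraint system (II), and let $c\in\{1,\dots,d\}$ be a counter. If $\mathbf{y}(c)>0$, then $n\mapsto n$ is a tight estimate of $\mathcal{C}[c]$ for the only type of $\mathcal{A}$. If $\mathbf{y}(c)=0$, then $n\mapsto n^2$ is a lower estimate of $\mathcal{C}[c]$ for the only type of $\mathcal{A}$.
   Context: Let $d\ge 1$. A $d$-dimensional VASS MDP is a tuple $\mathcal{A}=(Q,(Q_n,Q_p),T,P)$, where $Q$ is a finite nonempty set of states partitioned into nondeterministic states $Q_n$ and probabilistic states $Q_p$; $T\subseteq Q\times\mathbb{Z}^d\times Q$ is a finite set of transitions such that for every $p\in Q$ the set $\mathit{Out}(p)$ of transitions of the form $(p,\mathbf{u},q)$ is nonempty; and $P$ assigns to every $t\in\mathit{Out}(p)$ with $p\in Q_p$ a positive rational probability such that $\sum_{t\in\mathit{Out}(p)}P(t)=1$. $\mathit{In}(p)$ is the set of transitions of the form $(q,\mathbf{u},p)$; for $t=(p,\mathbf{u},q)$ write $\mathbf{u}_t=\mathbf{u}$. A strategy $\sigma$ maps every finite path ending in a state $p\in Q_n$ to a probability distribution over $\mathit{Out}(p)$. A configuration $p\mathbf{v}$ ($p\in Q$, $\mathbf{v}\in\mathbb{Z}^d$) is terminal if some component of $\mathbf{v}$ is negative. A computation from $p\mathbf{v}$ along an infinite path $p_0,\mathbf{u}_1,p_1,\dots$ is $p_0\mathbf{v}_0,p_1\mathbf{v}_1,\dots$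 with $\mathbf{v}_0=\mathbf{v}$, $\mathbf{v}_{i+1}=\mathbf{v}_i+\mathbf{u}_{i+1}$; $\mathit{Term}(\pi)$ is the least $j$ with $p_j\mathbf{v}_j$ terminal ($\infty$ if none). $\mathbb{P}^\sigma_{p\mathbf{v}}$ is the probability measure on computations from $p\mathbf{v}$ under $\sigma$. $\mathbf{n}$ is the vector with all components $n$. $\mathcal{C}[c](\pi)=\sup\{\mathbf{v}_i(c):0\le i<\mathit{Term}(\pi)\}$. $\mathcal{A}$ is strongly connected if its underlying graph is strongly connected; then $(Q,T)$ is its unique maximal end component $M$, every computation has MEC sequence $\mathit{mecs}=M$, and the only type is $\beta=M$. For $f:\mathbb{N}\to\mathbb{N}$: $f$ is a lower estimate of $\mathcal{C}[c]$ for $\beta$ if for every $\varepsilon>0$ there exist $p\in Q$ and strategies $\sigma_1,\sigma_2,\dots$ with $\liminf_{n\to\infty}\mathbb{P}^{\sigma_n}_{p\mathbf{n}}[\mathcal{C}[c]\ge f(n)^{1-\varepsilon}]=1$; $f$ is an upper estimate if for every $\varepsilon>0$, every $p\in Q$ and all strategies $\sigma_1,\sigma_2,\dots$, $\limsup_{n\to\infty}\mathbb{P}^{\sigma_n}_{p\mathbf{n}}[\mathcal{C}[c]\ge f(n)^{1+\varepsilon}]=0$; $f$ is a tight estimate if both. Constraint system (II): find $\mathbf{y}\in\mathbb{Z}^d$, $\mathbf{z}\in\mathbb{Z}^Q$ with $\mathbf{y}\ge\vec 0$, $\mathbf{z}\ge\vec 0$, $\mathbf{z}(q)-\mathbf{z}(p)+\sum_{i=1}^d\mathbf{u}(i)\mathbf{y}(i)\le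 0$ for every $(p,\mathbf{u},q)\in T$ with $p\in Q_n$, and $\sum_{t=(p,\mathbf{u},q)\in\mathit{Out}(p)}P(t)\big(\mathbf{z}(q)-\mathbf{z}(p)+\sum_{i=1}^d\mathbf{u}_t(i)\mathbf{y}(i)\big)\le 0$ for every $p\in Q_p$. Its objective inequalities are $\mathbf{y}(c)>0$ for each counter $c$, the strict versions of the inequality for each $(p,\mathbf{u},q)\in T$ with $p\in Q_n$, and the strict version of the probabilistic inequality for each $p\in Q_p$. A solution is maximal if every objective inequality satisfied strictly by some solution is satisfied strictly by it (such solutions exist since solutions are closed under addition). *)

(* Defs.v *)
From HB Require Import structures.
From mathcomp Require Import all_boot all_order all_algebra.
From mathcomp Require Import all_classical all_reals all_analysis.
Set Implicit Arguments. Unset Strict Implicit. Unset Printing Implicit Defensive.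
Import Order.TTheory GRing.Theory Num.Theory.
Local Open Scope ring_scope.

(* A d-dimensional VASS MDP.  States Q (finite, nonempty), partitioned into
   probabilistic states (is_prob) and nondeterministic ones (~~ is_prob).
   The finite transition set T is given as a finite type of transitions
   with source, update vector, target; distinct transitions are distinct
   triples (trans_inj).  Probabilities P are positive rationals on the
   outgoing transitions of probabilistic states, summing to 1. *)
Record VMDP (d : nat) := MkVMDP {
  state : finType;
  state_nonempty : exists p : state, True;
  is_prob : pred state;
  trans : finType;
  src : trans -> state;
  upd : trans -> 'I_d -> int;
  tgt : trans -> state;
  prob : trans -> rat;
  trans_inj : forall t t', src t = src t' -> upd t =1 upd t' ->
                tgt t = tgt t' -> t = t';
  out_nonempty : forall p : state, exists t : trans, src t = p;
  prob_pos : forall t, is_prob (src t) -> 0 < prob t;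
  prob_sum : forall p, is_prob p -> \sum_(t | src t == p) prob t = 1
}.

Arguments state {d}. Arguments is_prob {d}. Arguments trans {d}.
Arguments src {d}. Arguments upd {d}. Arguments tgt {d}. Arguments prob {d}.

Section VMDP_defs.
Variables (d : nat) (A : VMDP d).

Definition edge : rel (state A) :=
  fun p q => [exists t : trans A, (src A t == p) && (tgt A t == q)].
Definition strongly_connected : Prop := forall p q : state A, connect edge p q.

Definition dotu (y : 'I_d -> int) (t : trans A) : int :=
  \sum_(i < d) upd A t i * y i.
Definition tval (y : 'I_d -> int) (z : state A -> int) (t : trans A) : int :=
  z (tgt A t) - z (src A t) + dotu y t.
Definition pval (y : 'I_d -> int) (z : state A -> int) (p : state A) : rat :=
  \sum_(t | src A t == p) prob A t * (tval y z t)%:~R.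

Definition solII (y : 'I_d -> int) (z : state A -> int) : Prop :=
  (forall i, 0 <= y i) /\ (forall p, 0 <= z p) /\
  (forall t, ~~ is_prob A (src A t) -> tval y z t <= 0) /\
  (forall p, is_prob A p -> pval y z p <= 0).

Definition maximal_solII (y : 'I_d -> int) (z : state A -> int) : Prop :=
  solII y z /\
  (forall i, (exists y' z', solII y' z' /\ 0 < y' i) -> 0 < y i) /\
  (forall t, ~~ is_prob A (src A t) ->
     (exists y' z', solII y' z' /\ tval y' z' t < 0) -> tval y z t < 0) /\
  (forall p, is_prob A p ->
     (exists y' z', solII y' z' /\ pval y' z' p < 0) -> pval y z p < 0).

Variable R : realType.

(* A finite path p0, u1, p1, ..., uk, pk is represented by its initial state
   p0 and its sequence of transitions (transitions are determined by their
   triples). *)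
Definition last_state (p0 : state A) (h : seq (trans A)) : state A :=
  last p0 (map (tgt A) h).
Definition is_path (p0 : state A) (h : seq (trans A)) : bool :=
  if h is t :: h' then
    (src A t == p0) && path (fun t1 t2 => tgt A t1 == src A t2) t h'
  else true.

(* A (randomized, history-dependent) strategy: sigma p0 h t is the
   probability of choosing transition t after the finite path (p0, h),
   when this path ends in a nondeterministic state. *)
Definition strategy := state A -> seq (trans A) -> trans A -> R.

Definition is_strategy (sigma : strategy) : Prop :=
  forall p0 h, is_path p0 h -> ~~ is_prob A (last_state p0 h) ->
    (forall t, 0 <= sigma p0 h t) /\
    (forall t, src A t != last_state p0 h -> sigma p0 h t = 0) /\
    \sum_(t | src A t == last_state p0 h) sigma p0 h t = 1.

Definition step_prob (sigma : strategy) p0 h (t : trans A) : R :=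
  if src A t == last_state p0 h then
    (if is_prob A (src A t) then ratr (prob A t) else sigma p0 h t)
  else 0.

Fixpoint cyl_prob (sigma : strategy) p0 (h w : seq (trans A)) : R :=
  match w with
  | [::] => 1
  | t :: w' => step_prob sigma p0 h t * cyl_prob sigma p0 (rcons h t) w'
  end.

Definition vec_after (v0 : 'I_d -> int) (w : seq (trans A)) : 'I_d -> int :=
  fun k => v0 k + \sum_(t <- w) upd A t k.
Definition nonterminal (v : 'I_d -> int) : bool := [forall k, 0 <= v k].

(* the event  C[c] >= K  is witnessed within the first m steps:
   some i <= m with i < Term (configurations 0..i non-terminal)
   and v_i(c) >= K *)
Definition witness (v0 : 'I_d -> int) (c : 'I_d) (K : R) m
  (w : m.-tuple (trans A)) : bool :=
  [exists i : 'I_m.+1,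
     [forall j : 'I_m.+1, (j <= i)%N ==> nonterminal (vec_after v0 (take j w))]
     && (K <= (vec_after v0 (take i w) c)%:~R)].

Definition prob_within (sigma : strategy) (p : state A) (v0 : 'I_d -> int)
  (c : 'I_d) (K : R) (m : nat) : R :=
  \sum_(w : m.-tuple (trans A)) cyl_prob sigma p [::] w * (witness v0 c K w)%:R.

(* P^sigma_{p v0}[ C[c] >= K ]: the event is the increasing union over m of
   the events "witnessed within m steps", so its measure is the supremum. *)
Definition prob_Cge (sigma : strategy) (p : state A) (v0 : 'I_d -> int)
  (c : 'I_d) (K : R) : R :=
  sup [set x | exists m, x = prob_within sigma p v0 c K m].

Definition vconst (n : nat) : 'I_d -> int := fun _ => n%:Z.

Definition lower_estimate (c : 'I_d) (f : nat -> nat) : Prop :=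
  forall eps : R, 0 < eps ->
  exists (p : state A) (sigma : nat -> strategy),
    (forall n, is_strategy (sigma n)) /\
    limn_inf (fun n => prob_Cge (sigma n) p (vconst n) c
                          (powR (f n)%:R (1 - eps))) = 1.

Definition upper_estimate (c : 'I_d) (f : nat -> nat) : Prop :=
  forall eps : R, 0 < eps ->
  forall (p : state A) (sigma : nat -> strategy),
    (forall n, is_strategy (sigma n)) ->
    limn_sup (fun n => prob_Cge (sigma n) p (vconst n) c
                          (powR (f n)%:R (1 + eps))) = 0.

Definition tight_estimate (c : 'I_d) (f : nat -> nat) : Prop :=
  lower_estimate c f /\ upper_estimate c f.

End VMDP_defs.

(* Main.v *)
Require Import Defs.
From HB Require Import structures.
From mathcomp Require Import all_boot all_order all_algebra.
From mathcomp Require Import all_classical all_reals all_analysis.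
From mathcomp Require Import ring lra.
Set Implicit Arguments. Unset Strict Implicit. Unset Printing Implicit Defensive.
Import Order.TTheory GRing.Theory Num.Theory. Import numFieldNormedType.Exports.
Local Open Scope ring_scope.

(* If [y c > 0], then [z (state) + sum_i y i * v i] is a supermartingale which is
   nonnegative while the computation is alive and dominates [v c], so Ville's
   inequality gives the upper estimate; the initial value of [c] gives the lower one.

   If [y c = 0], then by maximality no solution of (II) has [y c > 0], and Farkas'
   lemma yields a nonnegative circulation on the transitions, compatible with the
   probabilities, whose effect is nonnegative on every counter and positive on [c].
   The support of the circulation splits into strongly connected components.  For
   each of its states [r] one follows the circulation inside the component of [r] and
   walks randomly towards it elsewhere.  This policy has a gain vector [g r], constant
   in the starting state, and a potential solving the Poisson equation; the gains,
   weighted by the flow through [r], add up to the effect of the circulation.  The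
   strategy runs these policies in a deterministic cyclic schedule with blocks of
   length [L = n^(1 - delta)], for [L] rounds.  Up to the potentials, a counter is its
   deterministic drift plus a martingale with bounded increments.  Block boundaries and
   incomplete rounds cost [O(L)], which is [o(n)], and by Kolmogorov's inequality the
   martingale stays below [n / 4] with probability [1 - O(L^2 / n^2)], while [c] gains
   an amount of order [L^2]. *)

(** * Farkas' lemma *)

Section Farkas.
Variables (F : realFieldType) (V : lmodType F).

Definition is_scalar (f : V -> F) :=
  forall k u v, f (k *: u + v) = k * f u + f v.

Lemma is_scalar0 f : is_scalar f -> f 0 = 0.
Proof. by move=> lf; have := lf (-1) 0 0; rewrite scaler0 addr0; lra. Qed.

Lemma is_scalarZ f k u : is_scalar f -> f (k *: u) = k * f u.
Proof. by move=> lf; rewrite -[_ *: _]addr0 lf is_scalar0 ?addr0. Qed.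

(* Bartl's induction: project along a vector violating the last constraint. *)
Lemma farkas_seq (J : eqType) (s : seq J) (a : J -> V -> F) (b : V -> F) :
  uniq s -> (forall j, is_scalar (a j)) -> is_scalar b ->
  (forall v, (forall j, j \in s -> a j v <= 0) -> b v <= 0) ->
  exists l : J -> F, (forall j, 0 <= l j) /\
    forall v, b v = \sum_(j <- s) l j * a j v.
Proof.
elim: s a b => [|j0 s IH] a b /=.
  move=> _ _ lb hb; exists (fun=> 0); split=> // v; rewrite big_nil.
  have h1 := hb v (fun _ h => match notF h with end).
  have h2 := hb ((-1) *: v) (fun _ h => match notF h with end).
  by move: h2; rewrite is_scalarZ //; lra.
case/andP=> j0s us la lb hb.
(* If the remaining constraints already force [b v <= 0], the multiplier of [j0] is zero. *)
have [hs|] := pselect (forall v, (forall j, j \in s -> a j v <= 0) -> b v <= 0).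
  have [l [l0 le]] := IH a b us la lb hs.
  exists (fun j => if j == j0 then 0 else l j); split=> [j|v].
    by case: ifP.
  rewrite big_cons eqxx mul0r add0r le; apply: eq_big_seq => j js.
  by case: eqP => // e; move: j0s; rewrite -e js.
case/existsNP=> w0 /not_implyP [w0s /negP]; rewrite -ltNge => bw0.
have aw0 : 0 < a j0 w0.
  rewrite ltNge; apply/negP => aw0; move: bw0; rewrite ltNge hb // => j.
  by rewrite inE => /orP[/eqP ->|/w0s].
(* Scaled so that [v - a j0 v *: w] projects onto the kernel of [a j0]; [w] still satisfies the
   other constraints and has [b w > 0]. *)
pose w := (a j0 w0)^-1 *: w0.
have aw : a j0 w = 1 by rewrite is_scalarZ // mulVf // gt_eqF.
have bw : 0 < b w by rewrite is_scalarZ // mulr_gt0 // invr_gt0.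
have ws j : j \in s -> a j w <= 0.
  by move=> js; rewrite is_scalarZ // pmulr_rle0 ?invr_gt0 // w0s.
have sub (f : V -> F) v : is_scalar f -> f (v - a j0 v *: w) = f v - f w * a j0 v.
  by move=> lf; rewrite addrC -scaleNr lf; ring.
have lsub (f : V -> F) : is_scalar f -> is_scalar (fun v => f v - f w * a j0 v).
  by move=> lf k u v; rewrite lf la; ring.
have [||v hv|l [l0 le]] := IH (fun j v => a j v - a j w * a j0 v)
  (fun v => b v - b w * a j0 v) us.
- by move=> j; apply: lsub.
- exact: lsub.
- rewrite -sub //; apply: hb => j; rewrite inE => /orP[/eqP ->|js].
    by rewrite sub // aw mul1r subrr.
  by rewrite sub // hv.
(* Undoing the projection leaves this coefficient in front of [a j0]; it is nonnegative because
   [b w > 0] and every [a i w <= 0]. *)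
exists (fun j => if j == j0 then b w - \sum_(i <- s) l i * a i w else l j).
split=> [j|v].
  case: ifP => // _; rewrite subr_ge0 (le_trans _ (ltW bw)) // big_seq.
  by apply: sumr_le0 => i /ws; apply: mulr_ge0_le0.
rewrite big_cons eqxx.
have -> : \sum_(j <- s) (if j == j0 then b w - \sum_(i <- s) l i * a i w else l j) * a j v
   = \sum_(j <- s) l j * a j v.
  by apply: eq_big_seq => j js; case: eqP => // e; move: j0s; rewrite -e js.
have := le v.
under eq_bigr do rewrite mulrBr mulrA.
rewrite sumrB -mulr_suml; lra.
Qed.

Lemma farkas (J : finType) (a : J -> V -> F) (b : V -> F) :
  (forall j, is_scalar (a j)) -> is_scalar b ->
  (forall v, (forall j, a j v <= 0) -> b v <= 0) ->
  exists l : J -> F, (forall j, 0 <= l j) /\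
    forall v, b v = \sum_j l j * a j v.
Proof.
move=> la lb hb.
have [|l [l0 le]] := farkas_seq (index_enum_uniq J) la lb.
  by move=> v hv; apply: hb => j; apply: hv; rewrite mem_index_enum.
by exists l.
Qed.

End Farkas.

Lemma common_denominator (I : finType) (f : I -> rat) :
  exists2 N : nat, (0 < N)%N & exists a : I -> int, forall i, N%:R * f i = (a i)%:~R.
Proof.
exists (\prod_i `|denq (f i)|)%N.
  by rewrite prodn_gt0 // => i; rewrite absz_gt0 denq_neq0.
exists (fun i => numq (f i) * (\prod_(j | j != i) `|denq (f j)|)%N%:Z) => i.
have -> (n : nat) : n%:R = n%:Z%:~R :> rat by rewrite pmulrn.
rewrite (bigD1 i) //= PoszM !intrM absz_denq mulrAC; congr (_ * _).
by rewrite mulrC -{1}[f i]divq_num_den divfK ?intr_eq0 ?denq_neq0.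
Qed.

(** * The Poisson equation *)

Section Poisson.
Variables (F : realFieldType) (d : nat) (A : VMDP d).
Local Notation Q := (state A).
Local Notation T := (trans A).
Local Notation src := (src A).
Local Notation tgt := (tgt A).

Definition step_rel (w : T -> F) : rel Q :=
  fun p q => [exists t, [&& src t == p, tgt t == q & 0 < w t]].

Variable pol : T -> F.
Hypothesis pol_ge0 : forall t, 0 <= pol t.
Hypothesis pol_sum : forall p, \sum_(t | src t == p) pol t = 1.
Variable r : Q.
Hypothesis to_r : forall p, connect (step_rel pol) p r.

(** Maximum principle: at a maximiser, a positive-weight step to a smaller value would push the
    average below the maximum, so maximality propagates along the path to [r]. *)
Lemma subharmonic_max (h : Q -> F) :
  (forall p, h p <= \sum_(t | src t == p) pol t * h (tgt t)) ->
  forall p, h p <= h r.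
Proof.
move=> sub.
have [m _ hm] := @arg_maxP _ _ _ r xpredT h isT.
have {}hm p : h p <= h m by exact: hm.
suff mr : h r = h m by move=> p; rewrite mr; exact: hm.
suff H p : connect (step_rel pol) m p -> h p = h m by exact: H (to_r m).
case/connectP=> s; elim/last_ind: s p => [|s q IH] p /=; first by move=> _ ->.
rewrite rcons_path last_rcons => /andP[ms /existsP[t /and3P[/eqP st /eqP tt wt]]] ->.
have hs := IH _ ms erefl.
apply/eqP; rewrite eq_le hm //= leNgt; apply/negP => lt.
have := sub (src t).
rewrite st hs leNgt => /negP; apply.
rewrite -st.
have -> : h m = \sum_(t' | src t' == src t) pol t' * h m.
  by rewrite -mulr_suml pol_sum mul1r.
rewrite (bigD1 t) //= [ltRHS](bigD1 t) //=.
apply: ltr_leD; first by rewrite tt ltr_pM2l.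
by apply: ler_sum => t' _; rewrite ler_wpM2l // hm.
Qed.

(** Up to changing signs, [g <= 0]. Then [h] is subharmonic, hence at most [h r = 0], and the
    equation at [r] forces [g = 0]; now [- h] is subharmonic too. *)
Lemma harmonic_eq0 (h : Q -> F) (g : F) : h r = 0 ->
  (forall p, h p = g + \sum_(t | src t == p) pol t * h (tgt t)) ->
  g = 0 /\ forall p, h p = 0.
Proof.
wlog g0 : h g / g <= 0.
  move=> H; case: (leP g 0) => [|/ltW g0]; first exact: H.
  move=> hr hh; have [||k0|e0 e1] := H (fun p => - h p) (- g).
  - by rewrite oppr_le0.
  - by rewrite hr oppr0.
  - rewrite {1}hh opprD; congr (_ + _); rewrite -sumrN.
    by apply: eq_bigr => t _; rewrite mulrN.
  - split; first by apply/eqP; rewrite -oppr_eq0 e0.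
    by move=> p; apply/eqP; rewrite -oppr_eq0 e1.
move=> hr hh.
have h0 : forall p, h p <= h r.
  by apply: subharmonic_max => p; rewrite {1}hh; lra.
have g00 : g = 0.
  apply/eqP; rewrite eq_le g0 /=; have := hh r; rewrite hr.
  have : \sum_(t | src t == r) pol t * h (tgt t) <= 0.
    by apply: sumr_le0 => t _; rewrite mulr_ge0_le0 // -hr h0.
  lra.
split=> // p; apply/eqP; rewrite eq_le -{1}hr h0 -oppr_le0 /=.
have -> : 0 = - h r by rewrite hr oppr0.
move: p; apply: (@subharmonic_max (fun p => - h p)) => p.
by rewrite {1}hh g00 add0r -sumrN; under [leRHS]eq_bigr do rewrite mulrN.
Qed.

(** Potentials are normalised to vanish at [r], which frees coordinate [r] for the gain. Domain and
    codomain then have the same dimension, so uniqueness yields existence. *)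
Definition poisson_map (h : {ffun Q -> F^o}) : {ffun Q -> F^o} :=
  [ffun p => h r + (if p == r then 0 else h p) -
     \sum_(t | src t == p) pol t * (if tgt t == r then 0 else h (tgt t))].

Lemma poisson_map_linear : linear poisson_map.
Proof.
move=> k u v; apply/ffunP=> p; rewrite !ffunE.
have e q : (if q == r then 0 else k * u q + v q) =
  k * (if q == r then 0 else u q) + (if q == r then 0 else v q).
  by case: ifP => // _; rewrite mulr0 addr0.
have -> : \sum_(t | src t == p) pol t * (if tgt t == r then 0 else (k *: u + v) (tgt t))
 = k * (\sum_(t | src t == p) pol t * (if tgt t == r then 0 else u (tgt t))) +
   \sum_(t | src t == p) pol t * (if tgt t == r then 0 else v (tgt t)).
  rewrite mulr_sumr -big_split; apply: eq_bigr => t _ /=.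
  by rewrite !ffunE e mulrDr mulrCA.
set a := \sum_(t | _) _; set b := \sum_(t | _) _.
have aux (x1 x2 x3 x4 : F) :
  k * x1 + x2 + (k * x3 + x4) - (k * a + b) = k * (x1 + x3 - a) + (x2 + x4 - b).
  by ring.
by rewrite e; exact: aux.
Qed.

HB.instance Definition _ :=
  GRing.isLinear.Build F {ffun Q -> F^o} {ffun Q -> F^o} _ poisson_map poisson_map_linear.

(* The unknown gain is stored in the coordinate [r] of the unknown potential. *)
Lemma poisson (f : T -> F) : exists (g : F) (h : Q -> F),
  forall p, \sum_(t | src t == p) pol t * (f t + h (tgt t) - h p) = g.
Proof.
pose phi : 'End({ffun Q -> F^o}) := linfun poisson_map.
have phiE u : phi u = poisson_map u by exact: lfunE.
(* A kernel element is a harmonic function with gain [- u r], which the maximum principle rules out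
   unless it is zero. *)
have inj : lker phi == 0%VS.
  apply/lker0P; apply: raddf_inj => u; rewrite [X in X = _ -> _]phiE => /ffunP phi0.
  have [||g0 h0] := @harmonic_eq0 (fun p => if p == r then 0 else u p) (- u r).
  - by rewrite eqxx.
  - move=> p; have := phi0 p; rewrite !ffunE.
    have aux (x1 x2 x3 : F) : x1 + x2 - x3 = 0 -> x2 = - x1 + x3 by lra.
    exact: aux.
  - apply/ffunP=> p; rewrite ffunE; have := h0 p.
    case: eqP => // -> _; apply/eqP; rewrite -oppr_eq0; exact/eqP.
pose u := (phi^-1)%VF [ffun p => \sum_(t | src t == p) pol t * f t].
have : phi u = [ffun p => \sum_(t | src t == p) pol t * f t] by rewrite lker0_lfunVK.
rewrite phiE => /ffunP hu.
exists (u r), (fun p => if p == r then 0 else u p) => p.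
have := hu p; rewrite !ffunE.
have aux (x1 x2 x3 x4 : F) : x1 + x2 - x3 = x4 -> x4 + x3 - 1 * x2 = x1 by lra.
have -> : \sum_(t | src t == p) pol t *
    (f t + (if tgt t == r then 0 else u (tgt t)) - (if p == r then 0 else u p)) =
  \sum_(t | src t == p) pol t * f t +
  \sum_(t | src t == p) pol t * (if tgt t == r then 0 else u (tgt t)) -
  (\sum_(t | src t == p) pol t) * (if p == r then 0 else u p).
  by rewrite mulr_suml -big_split -sumrB; apply: eq_bigr => t _ /=; ring.
by rewrite pol_sum; exact: aux.
Qed.

End Poisson.

(** * Policies from a circulation *)

Section Circulation.
Variables (d : nat) (A : VMDP d).
Local Notation Q := (state A).
Local Notation T := (trans A).
Local Notation src := (src A).
Local Notation tgt := (tgt A).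
Local Notation prob := (prob A).
Local Notation is_prob := (is_prob A).

Hypothesis A_connected : strongly_connected A.

Variable x : T -> rat.
Hypothesis x_ge0 : forall t, 0 <= x t.
Hypothesis x_flow : forall p, \sum_(t | tgt t == p) x t = \sum_(t | src t == p) x t.
Hypothesis x_prob : forall t, is_prob (src t) ->
  x t = prob t * \sum_(t' | src t' == src t) x t'.

Definition outflow p := \sum_(t | src t == p) x t.
Definition component : rel Q := connect (step_rel x).

Lemma outflow_ge0 p : 0 <= outflow p.
Proof. exact: sumr_ge0. Qed.

Lemma le_outflow t : x t <= outflow (src t).
Proof. by rewrite /outflow (bigD1 t) //= lerDl sumr_ge0. Qed.

Lemma sum_out (P : pred Q) (f : Q -> T -> rat) :
  \sum_(p | P p) \sum_(t | src t == p) f p t = \sum_(t | P (src t)) f (src t) t.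
Proof.
rewrite (exchange_big_dep (fun t => P (src t))) /=; last by move=> p t pP /eqP ->.
by apply: eq_bigr => t Pt; rewrite (big_pred1 (src t)) // => p; rewrite /= eq_sym;
  case: eqP => [->|]; rewrite ?Pt ?andbF.
Qed.

Lemma sum_in (P : pred Q) (f : Q -> T -> rat) :
  \sum_(p | P p) \sum_(t | tgt t == p) f p t = \sum_(t | P (tgt t)) f (tgt t) t.
Proof.
rewrite (exchange_big_dep (fun t => P (tgt t))) /=; last by move=> p t pP /eqP ->.
by apply: eq_bigr => t Pt; rewrite (big_pred1 (tgt t)) // => p; rewrite /= eq_sym;
  case: eqP => [->|]; rewrite ?Pt ?andbF.
Qed.

Lemma component_step t : 0 < x t -> component (src t) (tgt t).
Proof. by move=> xt; apply/connect1/existsP; exists t; rewrite !eqxx. Qed.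

(* Nothing leaves the set reachable from [tgt t], hence nothing enters it. *)
Lemma component_back t : 0 < x t -> component (tgt t) (src t).
Proof.
move=> xt; apply/negPn/negP => nc.
pose S := component (tgt t).
have : \sum_(t' | S (tgt t')) x t' = \sum_(t' | S (src t')) x t'.
  rewrite -(sum_in S (fun _ => x)) -(sum_out S (fun _ => x)).
  by apply: eq_bigr => p _; exact: x_flow.
rewrite (bigID (fun t' => S (src t'))) [RHS](bigID (fun t' => S (tgt t'))) /=.
rewrite [X in _ = _ + X]big1; last first.
  move=> t' /andP[s' nt']; apply/eqP; rewrite eq_le x_ge0 leNgt andbT.
  apply: contra nt' => xt'; exact: connect_trans s' (component_step xt').
under [X in X + _ = _]eq_bigl do rewrite andbC.
rewrite addr0 => /(canRL (addKr _)); rewrite addNr.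
rewrite (bigD1 t) /=; last by rewrite nc andbT /S /component connect0.
by apply/eqP; rewrite gt_eqF // ltr_pwDl // sumr_ge0.
Qed.

Lemma component_sym p q : component p q -> component q p.
Proof.
case/connectP=> s; elim/last_ind: s q => [|s q IH] q' /=.
  by move=> _ ->; exact: connect0.
rewrite rcons_path last_rcons => /andP[ms /existsP[t /and3P[/eqP st /eqP tt xt]]] ->.
by apply: connect_trans (IH _ ms erefl); rewrite -st -tt; exact: component_back.
Qed.

Lemma component_eq r p q : component r p -> component p q = component r q.
Proof.
move=> rp; apply/idP/idP; first exact: connect_trans.
by apply: connect_trans; exact: component_sym.
Qed.

(** Uniform at nondeterministic states. Every transition gets positive weight, so every edge of the
    graph can be followed. *)
Definition fallback t : rat :=
  if is_prob (src t) then prob t else (#|[pred t' | src t' == src t]|%:R)^-1.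

Lemma fallback_gt0 t : 0 < fallback t.
Proof.
rewrite /fallback; case: ifP => [|_]; first exact: prob_pos.
by rewrite invr_gt0 ltr0n; apply/card_gt0P; exists t; rewrite inE.
Qed.

Lemma fallback_sum p : \sum_(t | src t == p) fallback t = 1.
Proof.
rewrite /fallback; case pp: (is_prob p).
  rewrite -(prob_sum pp); apply: eq_bigr => t /eqP ->; by rewrite pp.
have [t0 st0] := out_nonempty p.
rewrite (eq_bigr (fun=> (#|[pred t' | src t' == p]|%:R)^-1)); last first.
  by move=> t /eqP ->; rewrite pp.
rewrite sumr_const -[_ *+ _]mulr_natl mulfV // pnatr_eq0 -lt0n.
by apply/card_gt0P; exists t0; apply/eqP.
Qed.

(** The test on [outflow] concerns an [r] off the support of the circulation: its component is [r]
    alone, with nothing to normalise. *)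
Definition component_policy r t : rat :=
  if component r (src t) && (0 < outflow (src t)) then x t / outflow (src t) else fallback t.

Lemma component_policy_ge0 r t : 0 <= component_policy r t.
Proof.
rewrite /component_policy; case: ifP => _; last exact: ltW (fallback_gt0 t).
by rewrite divr_ge0 ?outflow_ge0.
Qed.

Lemma component_policy_sum r p : \sum_(t | src t == p) component_policy r t = 1.
Proof.
rewrite /component_policy; case: (boolP (component r p && (0 < outflow p))) => c.
  rewrite (eq_bigr (fun t => x t / outflow p)); last by move=> t /eqP ->; rewrite c.
  by rewrite -mulr_suml mulfV // gt_eqF //; case/andP: c.
rewrite -[RHS](fallback_sum p); apply: eq_bigr => t /eqP ->.
by rewrite (negbTE c).
Qed.

Lemma component_policy_prob r t : is_prob (src t) -> component_policy r t = prob t.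
Proof.
move=> pt; rewrite /component_policy /fallback pt; case: ifP => // /andP[_ xs0].
by rewrite x_prob // mulfK // gt_eqF.
Qed.

(** Inside the component, symmetry gives a path back to [r] along the circulation. Outside, a path
    of the underlying graph is followed with [fallback] until it enters the component. *)
Lemma component_policy_to r p : connect (step_rel (component_policy r)) p r.
Proof.
have inB q : component r q -> connect (step_rel (component_policy r)) q r.
  move=> rq; case/connectP: (component_sym rq) => s.
  elim: s q rq => [|q' s IH] q rq /=; first by move=> _ ->; exact: connect0.
  case/andP=> /existsP[t /and3P[/eqP st /eqP tt xt]] qs ls.
  apply: (connect_trans (y := q')).
    apply/connect1/existsP; exists t; rewrite st tt !eqxx /= /component_policy st rq /=.
    have xs0 : 0 < outflow q by rewrite -st (lt_le_trans xt) // le_outflow.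
    by rewrite xs0 divr_gt0.
  apply: IH => //; rewrite /component (connect_trans rq) // -st -tt.
  exact: component_step.
case/connectP: (A_connected p r) => s.
elim: s p => [|q s IH] p /=; first by move=> _ ->; exact: connect0.
have [/inB //|npr] := boolP (component r p).
case/andP=> /existsP[t /andP[/eqP st /eqP tt]] qs ls.
apply: connect_trans (IH _ qs ls); apply/connect1/existsP; exists t.
by rewrite st tt !eqxx /component_policy st (negbTE npr) /= fallback_gt0.
Qed.

(** * Gains of the circulation policies *)

Section Gain.
Variables (f : T -> rat) (g : Q -> rat) (h : Q -> Q -> rat).
Hypothesis poisson_gh : forall r p,
  \sum_(t | src t == p) component_policy r t * (f t + h r (tgt t) - h r p) = g r.

(** Weight the Poisson equation at [p] by [outflow p] and sum over the component: the potentials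
    cancel by flow conservation, since no flow crosses the boundary of a component. *)
Lemma component_gain r :
  g r * \sum_(p | component r p) outflow p = \sum_(t | component r (src t)) x t * f t.
Proof.
rewrite mulr_sumr.
have -> : \sum_(p | component r p) g r * outflow p =
  \sum_(p | component r p) \sum_(t | src t == p) x t * (f t + h r (tgt t) - h r p).
  apply: eq_bigr => p rp; rewrite -(poisson_gh r p) mulr_suml.
  apply: eq_bigr => t /eqP st; rewrite mulrAC; congr (_ * _).
  (* Where the outflow is zero, [x t] vanishes as well and both sides are zero. *)
  rewrite /component_policy st rp /=; case: ltgtP (outflow_ge0 p) => // xsp _.
    by rewrite divfK // gt_eqF.
  rewrite -xsp mulr0; apply/esym/eqP.
  by rewrite eq_le x_ge0 andbT xsp -st le_outflow.
rewrite (sum_out (component r) (fun p t => x t * (f t + h r (tgt t) - h r p))).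
have -> : \sum_(t | component r (src t)) x t * (f t + h r (tgt t) - h r (src t)) =
  \sum_(t | component r (src t)) x t * f t +
  (\sum_(t | component r (src t)) x t * h r (tgt t) -
   \sum_(t | component r (src t)) x t * h r (src t)).
  by rewrite -sumrB -big_split; apply: eq_bigr => t _ /=; ring.
rewrite -[RHS]addr0; congr (_ + _); apply/eqP; rewrite subr_eq0; apply/eqP.
rewrite -(sum_out (component r) (fun p t => x t * h r p)).
transitivity (\sum_(t | component r (tgt t)) x t * h r (tgt t)).
  rewrite big_mkcond [RHS]big_mkcond; apply: eq_bigr => t _.
  case: ltgtP (x_ge0 t) => // [xt|<-] _; last by rewrite !mul0r !if_same.
  suff -> : component r (src t) = component r (tgt t) by [].
  apply/idP/idP=> c; apply: connect_trans c _; [exact: component_step|exact: component_back].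
rewrite -(sum_in (component r) (fun p t => x t * h r p)); apply: eq_bigr => p _.
by rewrite -!mulr_suml x_flow.
Qed.

(** The effect of each component is shared among its states in the proportions [outflow r / m r],
    which add up to one over the component. *)
Lemma total_gain : \sum_r outflow r * g r = \sum_t x t * f t.
Proof.
pose m p := \sum_(q | component p q) outflow q.
have m_gt0 p : 0 < outflow p -> 0 < m p.
  move=> xp; rewrite /m /component (bigD1 p) ?connect0 //= ltr_pwDl // sumr_ge0 // => *.
  exact: outflow_ge0.
have e r : outflow r * g r = \sum_(t | component r (src t)) (outflow r / m r) * (x t * f t).
  rewrite -mulr_sumr -component_gain -/(m r).
  case: ltgtP (outflow_ge0 r) => // [xr _|<- _]; last by rewrite !mul0r.
  by rewrite [g r * _]mulrC mulrA divfK // gt_eqF // m_gt0.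
under eq_bigr do rewrite e.
rewrite (exchange_big_dep xpredT) //=; apply: eq_bigr => t _.
rewrite -mulr_suml.
case: ltgtP (x_ge0 t) => // [xt _|<- _]; last by rewrite !mul0r mulr0.
have -> : \sum_(i | component i (src t)) outflow i / m i =
    \sum_(i | component (src t) i) outflow i / m (src t).
  rewrite (eq_bigl (component (src t))); last by move=> i; apply/idP/idP; exact: component_sym.
  apply: eq_bigr => i ci; congr (_ / _); rewrite /m; apply: eq_bigl => q.
  exact: component_eq.
by rewrite -mulr_suml mulfV ?mul1r // gt_eqF // m_gt0 // (lt_le_trans xt) // le_outflow.
Qed.

End Gain.
End Circulation.

(** * Duality for the constraint system *)

Section ScalarClosure.
Variables (F : realFieldType) (V : lmodType F).

Lemma is_scalarD (f g : V -> F) :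
  is_scalar f -> is_scalar g -> is_scalar (fun v => f v + g v).
Proof. by move=> lf lg k u v; rewrite lf lg; ring. Qed.

Lemma is_scalarN (f : V -> F) : is_scalar f -> is_scalar (fun v => - f v).
Proof. by move=> lf k u v; rewrite lf; ring. Qed.

Lemma is_scalarM (a : F) (f : V -> F) : is_scalar f -> is_scalar (fun v => a * f v).
Proof. by move=> lf k u v; rewrite lf; ring. Qed.

Lemma is_scalar_sum (I : finType) (P : pred I) (f : I -> V -> F) :
  (forall i, is_scalar (f i)) -> is_scalar (fun v => \sum_(i | P i) f i v).
Proof.
move=> lf k u v; rewrite mulr_sumr -big_split; apply: eq_bigr => i _; exact: lf.
Qed.

End ScalarClosure.

Section Duality.
Variables (d : nat) (A : VMDP d).
Local Notation Q := (state A).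
Local Notation T := (trans A).
Local Notation src := (src A).
Local Notation tgt := (tgt A).
Local Notation prob := (prob A).
Local Notation is_prob := (is_prob A).
Local Notation upd := (upd A).

(** The pair [(y, z)] as one rational vector, the form to which Farkas' lemma applies. *)
Definition potential := {ffun 'I_d + Q -> rat^o}.

Definition tchange (v : potential) (t : T) : rat :=
  v (inr (tgt t)) - v (inr (src t)) + \sum_i (upd t i)%:~R * v (inl i).

(** Indices whose state is of the other kind carry the zero functional. The sign condition on [z] is
    restored afterwards by a shift. *)
Definition sysII (j : 'I_d + T + Q) (v : potential) : rat :=
  match j with
  | inl (inl i) => - v (inl i)
  | inl (inr t) => if is_prob (src t) then 0 else tchange v t
  | inr p => if is_prob p then \sum_(t | src t == p) prob t * tchange v t else 0
  end.

Lemma is_scalar_coord a : is_scalar (fun v : potential => v a : rat).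
Proof. by move=> k u v; rewrite !ffunE. Qed.

Lemma is_scalar_tchange t : is_scalar (tchange^~ t).
Proof.
apply: is_scalarD; first apply: is_scalarD.
- exact: is_scalar_coord.
- by apply: is_scalarN; exact: is_scalar_coord.
- by apply: is_scalar_sum => i; apply: is_scalarM; exact: is_scalar_coord.
Qed.

Lemma is_scalar_sysII j : is_scalar (sysII j).
Proof.
case: j => [[i|t]|p] /=.
- by apply: is_scalarN; exact: is_scalar_coord.
- by move=> k u v /=; case: ifP => _; [rewrite mulr0 addr0 | exact: is_scalar_tchange].
- move=> k u v /=; case: ifP => _; last by rewrite mulr0 addr0.
  move: k u v; apply: (@is_scalar_sum _ _ _ (fun t => src t == p)
    (fun t v => prob t * tchange v t)) => t.
  by apply: is_scalarM; exact: is_scalar_tchange.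
Qed.

Variable c : 'I_d.
Hypothesis c_unbounded : forall y z, @solII d A y z -> y c <= 0.

(** A rational solution becomes an integral one after clearing denominators; adding a large constant
    to [z] makes it nonnegative and keeps all differences. *)
Lemma sysII_c (v : potential) : (forall j, sysII j v <= 0) -> v (inl c) <= 0.
Proof.
move=> hv; have [N N0 [a ha]] := common_denominator (v : 'I_d + Q -> rat).
have NQ : 0 < N%:R :> rat by rewrite ltr0n.
pose y i := a (inl i); pose z p := a (inr p) + \sum_q `|a (inr q)|.
have tvE t : (Defs.tval y z t)%:~R = N%:R * tchange v t.
  rewrite /Defs.tval /tchange /dotu /y /z.
  have -> (u w s : int) : u + s - (w + s) = u - w by ring.
  rewrite intrD intrB -!ha mulrDr mulrBr; congr (_ + _).
  rewrite mulr_sumr raddf_sum; apply: eq_bigr => i _ /=.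
  by rewrite intrM -ha; ring.
suff : y c <= 0 by rewrite -(ler_int rat) /y -ha pmulr_rle0.
apply: (@c_unbounded y z); split; [|split; [|split]].
- move=> i; rewrite -(ler_int rat) /y -ha pmulr_rge0 //.
  by have := hv (inl (inl i)); rewrite /= oppr_le0.
- move=> p; rewrite /z (bigD1 p) //= addrA addr_ge0 //; last exact: sumr_ge0.
  by rewrite -lerBlDl sub0r -normrN ler_norm.
- move=> t pt; rewrite -(ler_int rat) tvE pmulr_rle0 //.
  by have := hv (inl (inr t)); rewrite /= (negbTE pt).
- move=> p pp; rewrite /pval (eq_bigr (fun t => N%:R * (prob t * tchange v t))).
    rewrite -mulr_sumr pmulr_rle0 //.
    by have := hv (inr p); rewrite /= pp.
  by move=> t _; rewrite tvE; ring.
Qed.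

(** The Farkas multipliers for [v (inl c)] are the circulation. Testing the identity on basis
    vectors gives flow conservation from the state coordinates and the effects from the counter
    coordinates. *)
Lemma circulation_exists : exists x : T -> rat,
  [/\ forall t, 0 <= x t,
      forall p, \sum_(t | tgt t == p) x t = \sum_(t | src t == p) x t,
      forall t, is_prob (src t) -> x t = prob t * \sum_(t' | src t' == src t) x t',
      forall i, 0 <= \sum_t x t * (upd t i)%:~R
    & 0 < \sum_t x t * (upd t c)%:~R].
Proof.
have [l [l0 le]] := farkas is_scalar_sysII (is_scalar_coord (inl c)) sysII_c.
(* A probabilistic state has a single multiplier, distributed over its transitions according to
   [prob]. *)
pose x t := if is_prob (src t) then l (inr (src t)) * prob t else l (inl (inr t)).
have {le} le (v : potential) :
  v (inl c) = \sum_t x t * tchange v t - \sum_i l (inl (inl i)) * v (inl i).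
  rewrite le !big_sumType /= [RHS]addrC -addrA; congr (_ + _).
    by rewrite -sumrN; apply: eq_bigr => i _; rewrite mulrN.
  rewrite (eq_bigr (fun p => \sum_(t | src t == p)
     (if is_prob (src t) then x t * tchange v t else 0))); last first.
    move=> p _; case pp: (is_prob p); last first.
      by rewrite mulr0 big1 // => t /eqP ->; rewrite pp.
    rewrite mulr_sumr; apply: eq_bigr => t /eqP st.
    by rewrite /x st pp; ring.
  rewrite (sum_out xpredT (fun _ t => if is_prob (src t) then x t * tchange v t else 0)).
  rewrite -big_split; apply: eq_bigr => t _ /=; rewrite /x.
  by case: ifP => _; rewrite ?mulr0 ?add0r ?addr0.
pose delta b : potential := [ffun a => (a == b)%:R].
(* The multiplier of the constraint [y i >= 0] is the surplus of the effect on counter [i]; counter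
   [c] gains an extra unit. *)
have effect i : \sum_t x t * (upd t i)%:~R = (i == c)%:R + l (inl (inl i)).
  have := le (delta (inl i)); rewrite ffunE [in LHS]eq_sym.
  have -> : (inl i == inl c :> 'I_d + Q) = (i == c) by [].
  move=> ->; rewrite (bigD1 i) //= [in X in _ - X]big1 => [|j ji]; last first.
    by rewrite ffunE /eq_op /= (negbTE ji) mulr0.
  rewrite ffunE eqxx mulr1 addr0 subrK; apply: eq_bigr => t _; congr (_ * _).
  rewrite /tchange !ffunE subrr add0r (bigD1 i) //= big1 => [|j ji]; last first.
    by rewrite ffunE /eq_op /= (negbTE ji) mulr0.
  by rewrite ffunE eqxx mulr1 addr0.
exists x; split.
- move=> t; rewrite /x; case: ifP => // pt.
  by rewrite mulr_ge0 // ltW // prob_pos.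
- move=> p; have := le (delta (inr p)); rewrite ffunE /=.
  rewrite [X in _ - X]big1 => [|i _]; last by rewrite ffunE mulr0.
  rewrite subr0 => /esym e; apply/eqP; rewrite -subr_eq0; apply/eqP; rewrite -[RHS]e.
  rewrite [X in X - _]big_mkcond [X in _ - X]big_mkcond -sumrB.
  apply: eq_bigr => t _; rewrite /tchange !ffunE big1 => [|i _]; last by rewrite ffunE mulr0.
  rewrite addr0 mulrBr /eq_op /= -!/(_ == _).
  by case: eqP; case: eqP => _ _; rewrite ?mulr1 ?mulr0.
- move=> t pt; rewrite (eq_bigr (fun t' => l (inr (src t)) * prob t')) => [|t' /eqP st'].
    by rewrite -mulr_sumr (prob_sum pt) /x pt; ring.
  by rewrite /x st' pt.
- by move=> i; rewrite effect addr_ge0.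
- by rewrite effect eqxx ltr_wpDr.
Qed.

End Duality.

(** * Cylinder probabilities *)

Lemma sum_tuple0 (V : zmodType) (T : finType) (f : seq T -> V) :
  \sum_(w : 0.-tuple T) f w = f [::].
Proof.
by rewrite (big_pred1 [tuple]) // => w; apply/esym/eqP; exact: tuple0.
Qed.

Lemma sum_tupleS (V : zmodType) (T : finType) (f : seq T -> V) m :
  \sum_(w : m.+1.-tuple T) f w = \sum_t \sum_(w : m.-tuple T) f (t :: w).
Proof.
rewrite pair_bigA /= (reindex (fun tw : T * m.-tuple T => [tuple of tw.1 :: tw.2])) /=.
  by apply: eq_bigr => -[].
exists (fun w : m.+1.-tuple T => (thead w, [tuple of behead w])) => [[t w] _|w _] /=.
  by rewrite theadE; congr pair; apply: val_inj.
by rewrite -tuple_eta.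
Qed.

Section Process.
Variables (d : nat) (A : VMDP d) (R : realType).
Local Notation Q := (state A).
Local Notation T := (trans A).
Local Notation src := (src A).
Local Notation tgt := (tgt A).
Variables (sigma : strategy A R) (p0 : Q).
Hypothesis sigma_strategy : is_strategy sigma.

Local Notation step := (step_prob sigma p0).
Local Notation cyl := (cyl_prob sigma p0).

Lemma last_state_rcons h t : last_state p0 (rcons h t) = tgt t.
Proof. by rewrite /last_state map_rcons last_rcons. Qed.

Lemma is_path_rcons h t :
  is_path p0 (rcons h t) = is_path p0 h && (src t == last_state p0 h).
Proof.
case: h => [|t0 h] /=; first by rewrite andbT.
by rewrite rcons_path -andbA /last_state /= last_map [tgt _ == _]eq_sym.
Qed.

Lemma step_ge0 h t : is_path p0 h -> 0 <= step h t.
Proof.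
move=> hp; rewrite /step_prob; case: eqP => // st; case: ifP => [pt|/negbT npt].
  by rewrite ler0q ltW // prob_pos.
rewrite st in npt; by case: (sigma_strategy hp npt).
Qed.

Lemma step_sum h : is_path p0 h -> \sum_t step h t = 1.
Proof.
move=> hp; rewrite /step_prob -big_mkcond /=.
case pp: (is_prob A (last_state p0 h)); last first.
  have [_ [_ <-]] := sigma_strategy hp (negbT pp).
  by apply: eq_bigr => t /eqP ->; rewrite pp.
rewrite -(rmorph1 (@ratr R)) -(prob_sum pp) rmorph_sum.
by apply: eq_bigr => t /eqP ->; rewrite pp.
Qed.

Lemma step_path h t : is_path p0 h -> step h t != 0 -> is_path p0 (rcons h t).
Proof.
move=> hp; rewrite is_path_rcons hp /step_prob.
by have [//|_] := eqVneq (src t) (last_state p0 h); rewrite eqxx.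
Qed.

Lemma step_mean_le h (f g : T -> R) : is_path p0 h ->
  (forall t, src t = last_state p0 h -> f t <= g t) ->
  \sum_t step h t * f t <= \sum_t step h t * g t.
Proof.
move=> hp fg; apply: ler_sum => t _.
have [st|st] := eqVneq (src t) (last_state p0 h).
  by apply: ler_wpM2l; [exact: step_ge0 | exact: fg].
by rewrite /step_prob (negbTE st) !mul0r.
Qed.

Lemma cyl_ge0 h w : is_path p0 h -> 0 <= cyl h w.
Proof.
elim: w h => //= t w IH h hp.
have [->|s0] := eqVneq (step h t) 0; first by rewrite mul0r.
by rewrite mulr_ge0 ?step_ge0 // IH // step_path.
Qed.

Lemma cyl_sum m h : is_path p0 h -> \sum_(w : m.-tuple T) cyl h w = 1.
Proof.
elim: m h => [|m IH] h hp; first by rewrite (sum_tuple0 (cyl h)).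
rewrite (sum_tupleS (cyl h)) -[RHS](step_sum hp); apply: eq_bigr => t _ /=.
rewrite -mulr_sumr.
have [->|s0] := eqVneq (step h t) 0; first by rewrite mul0r.
by rewrite IH ?mulr1 // step_path.
Qed.

(** Recursive along [w] so that it unfolds in step with [cyl_prob]; the history [h] itself is also
    tested. *)
Fixpoint hits (bad : pred (seq T)) h w : bool :=
  bad h || (if w is t :: w' then hits bad (rcons h t) w' else false).

Lemma hitsP (bad : pred (seq T)) h w :
  reflect (exists2 i, (i <= size w)%N & bad (h ++ take i w)) (hits bad h w).
Proof.
elim: w h => [|t w IH] h /=.
  rewrite orbF; apply: (iffP idP) => [b|[[|//] _]]; first by exists 0%N; rewrite ?cats0.
  by rewrite cats0.
apply: (iffP orP) => [[b|/IH [i iw b]]|[[|i] iw b]].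
- by exists 0%N; rewrite ?take0 ?cats0.
- by exists i.+1; rewrite //= -cat_rcons.
- by left; rewrite take0 cats0 in b.
- by right; apply/IH; exists i; rewrite // cat_rcons.
Qed.

(** Induction on the remaining horizon [m]: a bad history costs at most the total mass one,
    otherwise one step is taken and the supermartingale condition applies. Letting [Phi] depend on
    [m] allows a time-dependent compensator. *)
Lemma ville_inequality (bad : pred (seq T)) (Phi : nat -> seq T -> R) :
  (forall m h, is_path p0 h -> 0 <= Phi m h) ->
  (forall m h, is_path p0 h -> bad h -> 1 <= Phi m h) ->
  (forall m h, is_path p0 h -> ~~ bad h ->
     \sum_t step h t * Phi m (rcons h t) <= Phi m.+1 h) ->
  forall m h, is_path p0 h ->
  \sum_(w : m.-tuple T) cyl h w * (hits bad h w)%:R <= Phi m h.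
Proof.
move=> Phi0 Phi1 Phis; elim=> [|m IH] h hp; have [b|nb] := boolP (bad h).
- rewrite (le_trans _ (Phi1 _ _ hp b)) // (sum_tuple0 (fun w => cyl h w * (hits bad h w)%:R)).
  by rewrite /= b mulr1.
- rewrite (sum_tuple0 (fun w => cyl h w * (hits bad h w)%:R)) /= (negbTE nb) mulr0.
  exact: Phi0.
- rewrite (le_trans _ (Phi1 _ _ hp b)) // -[leRHS](cyl_sum m.+1 hp); apply: ler_sum => w _.
  by rewrite ler_piMr ?cyl_ge0 //; case: hits.
- rewrite (sum_tupleS (fun w => cyl h w * (hits bad h w)%:R)) (le_trans _ (Phis _ _ hp nb)) //.
  apply: ler_sum => t _ /=; rewrite (negbTE nb) /=.
  under eq_bigr do rewrite -mulrA.
  rewrite -mulr_sumr.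
  have [->|s0] := eqVneq (step h t) 0; first by rewrite !mul0r.
  by rewrite ler_wpM2l ?step_ge0 // IH // step_path.
Qed.

Variables (v0 : 'I_d -> int) (c : 'I_d) (K : R).

Lemma prob_within_ge0 m : 0 <= prob_within sigma p0 v0 c K m.
Proof. by apply: sumr_ge0 => w _; rewrite mulr_ge0 ?ler0n // cyl_ge0. Qed.

Lemma prob_within_le1 m : prob_within sigma p0 v0 c K m <= 1.
Proof.
rewrite -[leRHS](@cyl_sum m [::]) //; apply: ler_sum => w _.
by rewrite ler_piMr ?cyl_ge0 //; case: witness.
Qed.

Lemma prob_within_le_Cge m :
  prob_within sigma p0 v0 c K m <= prob_Cge sigma p0 v0 c K.
Proof.
apply: ub_le_sup; last by exists m.
by exists 1 => _ [k ->]; exact: prob_within_le1.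
Qed.

Lemma prob_Cge_le b : (forall m, prob_within sigma p0 v0 c K m <= b) ->
  prob_Cge sigma p0 v0 c K <= b.
Proof.
move=> hb; apply: ge_sup; first by exists (prob_within sigma p0 v0 c K 0), 0%N.
by move=> _ [k ->].
Qed.

Lemma prob_Cge_ge0 : 0 <= prob_Cge sigma p0 v0 c K.
Proof. exact: le_trans (prob_within_ge0 0) (prob_within_le_Cge 0). Qed.

Lemma prob_Cge_le1 : prob_Cge sigma p0 v0 c K <= 1.
Proof. by apply: prob_Cge_le; exact: prob_within_le1. Qed.

Lemma prob_within_ge (bad : pred (seq T)) m b :
  (forall w : m.-tuple T, ~~ hits bad [::] w -> witness v0 c K w) ->
  \sum_(w : m.-tuple T) cyl [::] w * (hits bad [::] w)%:R <= b ->
  1 - b <= prob_within sigma p0 v0 c K m.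
Proof.
move=> hw hb; rewrite lerBlDr; apply: le_trans (lerD (lexx _) hb).
rewrite -[leLHS](@cyl_sum m [::]) // -big_split; apply: ler_sum => w _ /=.
rewrite -mulrDr ler_peMr ?cyl_ge0 //.
by case: (boolP (hits _ _ _)) => [_|/hw ->]; rewrite ?lerDr ?lerDl.
Qed.

End Process.

(** * The upper estimate *)

Section Limits.
Variable R : realType.

Lemma cvg_natP (u : nat -> R) (l : R) :
  (forall eta, 0 < eta -> exists N, forall n, (N <= n)%N -> `|l - u n| <= eta) ->
  (u n @[n --> \oo] --> l)%classic.
Proof.
move=> H; apply/cvgrPdist_le => eta /H [N hN].
by exists N => // n /= Nn; exact: hN.
Qed.

Lemma limn_inf_eq1 (u : nat -> R) : (forall n, u n <= 1) ->
  (forall eta, 0 < eta -> exists N, forall n, (N <= n)%N -> 1 - eta <= u n) ->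
  limn_inf u = 1.
Proof.
move=> u1 H; have /cvg_limn_inf_sup [-> //] : (u n @[n --> \oo] --> (1 : R))%classic.
apply: cvg_natP => eta /H [N hN]; exists N => n /hN h.
by rewrite ger0_norm ?subr_ge0 // lerBlDr -lerBlDl.
Qed.

Lemma limn_sup_eq0 (u : nat -> R) : (forall n, 0 <= u n) ->
  (forall eta, 0 < eta -> exists N, forall n, (N <= n)%N -> u n <= eta) ->
  limn_sup u = 0.
Proof.
move=> u0 H; have /cvg_limn_inf_sup [_ -> //] : (u n @[n --> \oo] --> (0 : R))%classic.
apply: cvg_natP => eta /H [N hN]; exists N => n /hN h.
by rewrite sub0r normrN ger0_norm.
Qed.

Lemma powR_nat_small (e eta : R) : 0 < e -> 0 < eta ->
  exists N, forall n, (N <= n)%N -> n%:R `^ (- e) <= eta.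
Proof.
(* The threshold is the point where [n ^ - e] equals [eta]. *)
move=> e0 eta0; exists (Num.truncn (eta^-1 `^ e^-1)).+1 => n Nn.
have lt : eta^-1 `^ e^-1 < n%:R :> R.
  by apply: lt_le_trans (real_truncnS_gt _) _; rewrite ?num_real // ler_nat.
rewrite powRN -[leRHS]invrK lef_pV2 ?posrE ?invr_gt0 //; last first.
  by rewrite powR_gt0 // (le_lt_trans _ lt) // powR_ge0.
have -> : eta^-1 = (eta^-1 `^ e^-1) `^ e.
  by rewrite -powRrM mulVf ?gt_eqF // powRr1 // invr_ge0 ltW.
apply: ge0_ler_powR; rewrite ?nnegrE ?powR_ge0 ?(ltW lt) ?(ltW e0) //.
Qed.

End Limits.

Section VecAfter.
Variables (d : nat) (A : VMDP d) (v0 : 'I_d -> int).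
Local Notation T := (trans A).

Lemma vec_after_rcons (h : seq T) t k :
  vec_after v0 (rcons h t) k = vec_after v0 h k + upd A t k.
Proof. by rewrite /vec_after big_rcons addrA. Qed.

Definition alive (h : seq T) : bool :=
  [forall j : 'I_(size h).+1, nonterminal (vec_after v0 (take j h))].

Lemma aliveP (h : seq T) :
  reflect (forall j, (j <= size h)%N -> nonterminal (vec_after v0 (take j h))) (alive h).
Proof.
apply: (iffP forallP) => [H j jh|H j]; first exact: (H (Ordinal (jh : j < (size h).+1)%N)).
by apply: H; rewrite -ltnS ltn_ord.
Qed.

Lemma alive_rcons (h : seq T) t : alive (rcons h t) -> alive h.
Proof.
move/aliveP=> H; apply/aliveP => j jh; have := H j.
by rewrite size_rcons -cats1 takel_cat //; apply; exact: leqW.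
Qed.

Lemma alive_nonneg (h : seq T) k : alive h -> 0 <= vec_after v0 h k.
Proof.
by move/aliveP/(_ (size h) (leqnn _)); rewrite take_size => /forallP.
Qed.

Variable (R : realType).

Lemma witnessP (c : 'I_d) (K : R) m (w : m.-tuple T) :
  reflect (exists i : nat,
            [/\ (i <= m)%N, alive (take i w) & K <= (vec_after v0 (take i w) c)%:~R])
          (witness v0 c K w).
Proof.
apply: (iffP existsP) => [[i /andP[/forallP al Kc]]|[i [im /aliveP al Kc]]].
  exists i; split=> //; first by rewrite -ltnS.
  have im : (i <= m)%N by rewrite -ltnS.
  apply/aliveP => j; rewrite size_takel ?size_tuple // => ji.
  have jm : (j < m.+1)%N by rewrite ltnS (leq_trans ji).
  by have := al (Ordinal jm); rewrite /= ji /= take_takel.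
exists (Ordinal (im : i < m.+1)%N); rewrite Kc andbT; apply/forallP => j.
apply/implyP => ji; have := al j; rewrite size_takel ?size_tuple //.
by rewrite take_takel //; apply.
Qed.

End VecAfter.

(** * The supermartingale given by a solution of (II) *)

Section Upper.
Variables (d : nat) (A : VMDP d) (R : realType).
Local Notation Q := (state A).
Local Notation T := (trans A).
Variables (sigma : strategy A R) (p0 : Q).
Hypothesis sigma_strategy : is_strategy sigma.
Variables (y : 'I_d -> int) (z : Q -> int).
Hypothesis yz_sol : solII y z.

Local Notation tv := (Defs.tval y z).

Lemma tval_mean_le0 h : is_path p0 h ->
  \sum_t step_prob sigma p0 h t * (tv t)%:~R <= 0.
Proof.
case: yz_sol => _ [_ [hn hp]] ph.
have [pp|np] := boolP (is_prob A (last_state p0 h)).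
  suff -> : \sum_t step_prob sigma p0 h t * (tv t)%:~R =
    ratr (pval y z (last_state p0 h)) :> R by rewrite -(rmorph0 (@ratr R)) ler_rat hp.
  rewrite /pval rmorph_sum [RHS]big_mkcond /=; apply: eq_bigr => t _.
  rewrite /step_prob; case: eqP => [->|_]; last by rewrite mul0r.
  by rewrite pp rmorphM /= ratr_int.
apply: le_trans (step_mean_le sigma_strategy ph (g := fun=> 0) _) _.
  by move=> t st; rewrite lerz0 hn // st.
by rewrite big1 // => t _; rewrite mulr0.
Qed.

Variable v0 : 'I_d -> int.

Definition energy (h : seq T) : int :=
  z (last_state p0 h) + \sum_i vec_after v0 h i * y i.

Definition max_change : int := \sum_t `|tv t|.

Lemma energy_rcons h t : src A t = last_state p0 h ->
  energy (rcons h t) = energy h + tv t.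
Proof.
move=> st; rewrite /energy last_state_rcons /Defs.tval /dotu st.
under eq_bigr do rewrite vec_after_rcons mulrDl.
by rewrite big_split /=; ring.
Qed.

Lemma energy_ge c h : alive v0 h -> vec_after v0 h c * y c <= energy h.
Proof.
case: yz_sol => y0 [z0 _] al; rewrite /energy (bigD1 c) //= addrCA lerDl addr_ge0 //.
by apply: sumr_ge0 => i _; rewrite mulr_ge0 // alive_nonneg.
Qed.

Lemma energy_ge0 h : alive v0 h -> 0 <= energy h.
Proof.
case: yz_sol => y0 [z0 _] al; rewrite /energy addr_ge0 //.
by apply: sumr_ge0 => i _; rewrite mulr_ge0 // alive_nonneg.
Qed.

Lemma max_change_ge t : - tv t <= max_change.
Proof.
rewrite /max_change (bigD1 t) //= (le_trans (ler_norm _)) // normrN lerDl.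
exact: sumr_ge0.
Qed.

Lemma max_change_ge0 : 0 <= max_change.
Proof. exact: sumr_ge0. Qed.

(* [energy] may become negative when a counter does, but by at most [max_change]. *)
Lemma prob_Cge_energy (c : 'I_d) (K : R) : 0 < y c -> 0 < K ->
  prob_Cge sigma p0 v0 c K <= (`|energy [::]| + max_change)%:~R / K.
Proof.
move=> yc K0.
(* [Phi] is set to zero after termination. The shift by [max_change] keeps the unrestricted value
   nonnegative at that step, so this only lowers the mean. *)
pose Phi (m : nat) h : R := if alive v0 h then (energy h + max_change)%:~R / K else 0.
pose bad (h : seq T) := alive v0 h && (K <= (vec_after v0 h c)%:~R).
apply: prob_Cge_le => m.
have Phi_ub : Phi m [::] <= (`|energy [::]| + max_change)%:~R / K.
  rewrite /Phi; case: ifP => _.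
    by rewrite ler_wpM2r ?invr_ge0 ?(ltW K0) // ler_int lerD2r ler_norm.
  by rewrite divr_ge0 ?(ltW K0) // ler0z addr_ge0 // max_change_ge0.
apply: le_trans Phi_ub.
apply: le_trans _ (@ville_inequality _ _ _ sigma p0 sigma_strategy bad Phi _ _ _ m [::] isT).
- rewrite /prob_within; apply: ler_sum => w _; rewrite ler_wpM2l ?cyl_ge0 // ler_nat.
  case: witnessP => // -[i [im al Kc]]; suff -> : hits bad [::] w by [].
  by apply/hitsP; exists i; rewrite ?size_tuple //= /bad al.
- move=> k h _; rewrite /Phi; case: ifP => // al.
  by rewrite divr_ge0 ?(ltW K0) // ler0z addr_ge0 ?max_change_ge0 // energy_ge0.
(* Integrality turns [0 < y c] into [1 <= y c], so the energy dominates the counter. *)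
- move=> k h _ /andP[al Kc]; rewrite /Phi al ler_pdivlMr // mul1r (le_trans Kc) // ler_int.
  rewrite (le_trans _ (lerD (energy_ge c al) max_change_ge0)) // addr0.
  by rewrite ler_peMr ?alive_nonneg // -gtz0_ge1.
- move=> k h ph _; rewrite /Phi; case: ifP => [al|/negbT nal]; last first.
    by rewrite big1 // => t _; rewrite ifN ?mulr0 //; apply: contra nal; exact: alive_rcons.
  apply: (@le_trans _ _ (\sum_t step_prob sigma p0 h t *
     ((energy h + max_change)%:~R / K + (tv t)%:~R / K))).
    apply: step_mean_le => // t st; rewrite -mulrDl -intrD.
    have -> : energy h + max_change + tv t = energy (rcons h t) + max_change.
      by rewrite energy_rcons // [LHS]addrAC.
    case: ifP => // _; rewrite divr_ge0 ?(ltW K0) // ler0z energy_rcons // -addrA.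
    by rewrite addr_ge0 ?energy_ge0 // addrC -lerBlDr sub0r max_change_ge.
  under eq_bigr do rewrite mulrDr mulrA.
  rewrite big_split -!mulr_suml step_sum // mul1r gerDl /=.
  under eq_bigr do rewrite mulrA.
  by rewrite -mulr_suml pmulr_lle0 ?invr_gt0 // tval_mean_le0.
Qed.

End Upper.

(** The initial energy is at most linear in [n], so against the level [n ^ (1 + eps)] the bound is
    [C * n ^ - eps]. *)
Lemma upper_estimate_linear (R : realType) (d : nat) (A : VMDP d)
  (y : 'I_d -> int) (z : state A -> int) (c : 'I_d) :
  solII y z -> 0 < y c -> upper_estimate A R c id.
Proof.
move=> sol yc eps eps0 p sigma hs; apply: limn_sup_eq0 => [n|eta eta0].
  exact: prob_Cge_ge0.
have [y0 [z0 _]] := sol.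
pose C : R := (z p + \sum_i y i + max_change y z)%:~R.
have C0 : 0 <= C by rewrite ler0z !addr_ge0 ?max_change_ge0 // sumr_ge0.
have C1 : 0 < C + 1 by rewrite ltr_wpDl.
have [N hN] := powR_nat_small eps0 (divr_gt0 eta0 C1).
exists N.+1 => n Nn; have n0 : (0 < n)%N by exact: leq_trans Nn.
have nR : 0 < n%:R :> R by rewrite ltr0n.
rewrite (le_trans (prob_Cge_energy _ (hs n) sol _ yc _)) ?powR_gt0 //.
rewrite powRD; last by rewrite gt_eqF // addr_gt0.
rewrite powRr1 // invfM mulrA -powRN.
have : (`|energy p y z (vconst n) [::]| + max_change y z)%:~R / n%:R <= C.
  rewrite ler_pdivrMr // /C (pmulrn _ n) -intrM ler_int ger0_norm; last first.
    rewrite addr_ge0 // sumr_ge0 // => i _; rewrite mulr_ge0 //.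
    by rewrite /vec_after big_nil addr0.
  rewrite /energy /last_state /=.
  rewrite !mulrDl; apply: lerD; first apply: lerD.
  - by rewrite ler_peMr.
  - rewrite mulr_suml; apply: ler_sum => i _.
    by rewrite /vec_after big_nil addr0 mulrC.
  - by rewrite ler_peMr // max_change_ge0.
move=> le1; apply: le_trans (ler_wpM2r (powR_ge0 _ _) le1) _.
apply: le_trans (ler_wpM2l C0 (hN n (ltnW Nn))) _.
by rewrite mulrCA ger_pMr // ler_pdivrMr ?ltr_wpDl // mul1r lerDl.
Qed.

(** * Scheduled policies *)

Section CyclicSchedule.
Variables (R : realFieldType) (Q : eqType) (r0 : Q) (lst : seq Q) (L : nat).
Local Notation W := (size lst).
Hypothesis L_gt0 : (0 < L)%N.
Hypothesis W_gt0 : (0 < W)%N.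

Definition schedule (i : nat) : Q := nth r0 lst ((i %/ L) %% W).

Variable f : Q -> R.

Lemma sum_blocks q : \sum_(i < (q * L)%N) f (schedule i) =
  L%:R * \sum_(b < q) f (nth r0 lst (b %% W)).
Proof.
elim: q => [|q IH]; first by rewrite !big_ord0 mulr0.
rewrite mulSnr big_split_ord /= IH big_ord_recr /= mulrDr; congr (_ + _).
rewrite mulr_natl -[in RHS](card_ord L) -sumr_const; apply: eq_bigr => i _.
by rewrite /schedule divnMDl // divn_small // addn0.
Qed.

Lemma sum_rounds k : \sum_(b < (k * W)%N) f (nth r0 lst (b %% W)) =
  k%:R * \sum_(r <- lst) f r.
Proof.
elim: k => [|k IH]; first by rewrite !big_ord0 mul0r.
rewrite mulSnr big_split_ord /= IH -natr1 mulrDl mul1r; congr (_ + _).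
rewrite (big_nth r0) big_mkord; apply: eq_bigr => i _.
by rewrite modnMDl modn_small.
Qed.

(** Complete rounds contribute a nonnegative amount; the incomplete one has fewer than [W * L]
    steps, each losing at most [G]. *)
Lemma schedule_sum_ge (G : R) i : (forall r, `|f r| <= G) ->
  0 <= \sum_(r <- lst) f r -> - (W * L)%:R * G <= \sum_(j < i) f (schedule j).
Proof.
move=> fG f0; have G0 : 0 <= G by exact: le_trans (normr_ge0 _) (fG r0).
rewrite (divn_eq i (W * L)) big_split_ord /= mulnA sum_blocks sum_rounds.
rewrite -[leLHS]add0r lerD //; first by rewrite !mulr_ge0.
apply: (@le_trans _ _ (- (i %% (W * L))%:R * G)).
  by rewrite !mulNr lerN2 ler_wpM2r // ler_nat ltnW // ltn_mod muln_gt0 W_gt0.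
rewrite mulNr mulr_natl -[in leLHS](card_ord (i %% _)) -sumr_const -sumrN.
apply: ler_sum => j _.
by have /ler_normlP[+ _] := fG (schedule (i %/ (W * L) * W * L + j)); rewrite lerNl.
Qed.

End CyclicSchedule.

Section PolicyStrategy.
Variables (d : nat) (A : VMDP d) (R : realType).
Local Notation Q := (state A).
Local Notation T := (trans A).
Local Notation src := (src A).
Local Notation tgt := (tgt A).

Definition policy_strategy (pol : nat -> T -> rat) : strategy A R :=
  fun p0 h t => if src t == last_state p0 h then ratr (pol (size h) t) else 0.

Variable pol : nat -> T -> rat.
Hypothesis pol_ge0 : forall i t, 0 <= pol i t.
Hypothesis pol_sum : forall i p, \sum_(t | src t == p) pol i t = 1.
Hypothesis pol_prob : forall i t, is_prob A (src t) -> pol i t = prob A t.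

Lemma is_strategy_policy : is_strategy (policy_strategy pol).
Proof.
move=> p0 h _ _; rewrite /policy_strategy; split; [|split] => [t|t /negbTE -> //|].
  by case: ifP => // _; rewrite ler0q.
rewrite -(rmorph1 (@ratr R)) -(pol_sum (size h) (last_state p0 h)) rmorph_sum.
by apply: eq_bigr => t ->.
Qed.

Lemma step_prob_policy p0 h t : step_prob (policy_strategy pol) p0 h t =
  if src t == last_state p0 h then ratr (pol (size h) t) else 0.
Proof.
rewrite /step_prob /policy_strategy; case: eqP => // _; case: ifP => // pt.
by rewrite pol_prob.
Qed.

End PolicyStrategy.

(** * The walk under the scheduled policies: drift, potentials and martingale *)

Section ScheduledWalk.
Variables (d : nat) (A : VMDP d) (R : realType).
Local Notation Q := (state A).
Local Notation T := (trans A).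
Local Notation src := (src A).
Local Notation tgt := (tgt A).

Variable pol : Q -> T -> rat.
Hypothesis pol_ge0 : forall r t, 0 <= pol r t.
Hypothesis pol_sum : forall r p, \sum_(t | src t == p) pol r t = 1.
Hypothesis pol_prob : forall r t, is_prob A (src t) -> pol r t = prob A t.

Variables (g : Q -> 'I_d -> R) (h : Q -> 'I_d -> Q -> R).
Hypothesis poisson_gh : forall r k p, \sum_(t | src t == p)
  ratr (pol r t) * ((upd A t k)%:~R + h r k (tgt t) - h r k p - g r k) = 0.

Variables (H G D : R).
Hypothesis h_le : forall r k p, `|h r k p| <= H.
Hypothesis g_le : forall r k, `|g r k| <= G.
Hypothesis increment_le : forall r k p t,
  `|(upd A t k)%:~R + h r k (tgt t) - h r k p - g r k| <= D.

Variables (lst : seq Q) (c : 'I_d).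
Hypothesis lst_gain : forall k, 0 <= \sum_(r <- lst) g r k.
Hypothesis lst_gain_c : 0 < \sum_(r <- lst) g r c.

Variables (p0 : Q) (L : nat).
Hypothesis L_gt0 : (0 < L)%N.

Local Notation W := (size lst).
Local Notation phase := (schedule p0 lst L).
Local Notation hist := (seq T).

Definition scheduled_strategy : strategy A R :=
  policy_strategy R (fun i => pol (phase i)).

Lemma scheduled_is_strategy : is_strategy scheduled_strategy.
Proof. by apply: is_strategy_policy. Qed.

Lemma lst_gt0 : (0 < W)%N.
Proof. by move: lst_gain_c; case: lst => //; rewrite big_nil ltxx. Qed.

Definition pos (w : hist) (i : nat) : Q := last_state p0 (take i w).

(** Each step uses the potential of the policy then active, so the sum telescopes inside a block. *)
Definition correction (w : hist) k : R :=
  \sum_(j < size w) (h (phase j) k (pos w j.+1) - h (phase j) k (pos w j)).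

(** The martingale part of the displacement: its increments are the residuals of the Poisson
    equation. *)
Definition noise (w : hist) k : R :=
  (\sum_(t <- w) upd A t k)%:~R + correction w k - \sum_(j < size w) g (phase j) k.

Lemma pos_rcons w t i : (i <= size w)%N -> pos (rcons w t) i = pos w i.
Proof. by move=> iw; rewrite /pos -cats1 takel_cat. Qed.

Lemma pos_size w : pos w (size w) = last_state p0 w.
Proof. by rewrite /pos take_size. Qed.

Lemma correction_rcons w t k : correction (rcons w t) k = correction w k +
  (h (phase (size w)) k (tgt t) - h (phase (size w)) k (last_state p0 w)).
Proof.
rewrite /correction size_rcons big_ord_recr /=; congr (_ + (_ - _)).
- by apply: eq_bigr => i _; rewrite !pos_rcons // ltnW.
- by rewrite -(size_rcons w t) pos_size last_state_rcons.
- by rewrite pos_rcons // pos_size.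
Qed.

Lemma noise_rcons w t k : noise (rcons w t) k = noise w k +
  ((upd A t k)%:~R + h (phase (size w)) k (tgt t) -
    h (phase (size w)) k (last_state p0 w) - g (phase (size w)) k).
Proof.
rewrite /noise correction_rcons big_rcons size_rcons big_ord_recr /= intrD.
ring.
Qed.

(** After subtracting the current potential at the current state, the sum changes only when a block
    boundary swaps potentials, at a cost of at most [2 * H]. *)
Lemma correction_le w k : `|correction w k| <= H * (2 * (size w %/ L)%:R + 2).
Proof.
have H0 : 0 <= H by exact: le_trans (normr_ge0 _) (h_le p0 k p0).
suff B : `|correction w k - h (phase (size w)) k (last_state p0 w)| <=
    H * (2 * (size w %/ L)%:R + 1).
  rewrite -[correction w k](subrK (h (phase (size w)) k (last_state p0 w))).
  apply: le_trans (ler_normD _ _) _; have := h_le (phase (size w)) k (last_state p0 w).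
  lra.
elim/last_ind: w => [|w t IH].
  by rewrite /correction big_ord0 sub0r normrN div0n mulr0 add0r mulr1 h_le.
rewrite correction_rcons last_state_rcons size_rcons.
set q := last_state p0 w in IH *; set q' := tgt t.
have -> : correction w k + (h (phase (size w)) k q' - h (phase (size w)) k q)
    - h (phase (size w).+1) k q' = correction w k - h (phase (size w)) k q +
    (h (phase (size w)) k q' - h (phase (size w).+1) k q') by ring.
apply: le_trans (ler_normD _ _) _.
have [e|] := eqVneq (size w %/ L)%N ((size w).+1 %/ L)%N.
  by rewrite /schedule -e subrr normr0 addr0.
move=> ne; have lt : (size w %/ L < (size w).+1 %/ L)%N.
  by rewrite ltn_neqAle ne leq_div2r.
have {}lt : (size w %/ L)%:R + 1 <= ((size w).+1 %/ L)%:R :> R.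
  by rewrite natr1 ler_nat.
have := ler_normB (h (phase (size w)) k q') (h (phase (size w).+1) k q').
have := h_le (phase (size w)) k q'; have := h_le (phase (size w).+1) k q'.
have : H * (2 * (size w %/ L)%:R + 1) + 2 * H <= H * (2 * ((size w).+1 %/ L)%:R + 1).
  have := ler_wpM2l H0 lt; lra.
lra.
Qed.

Lemma step_mean_increment w k : is_path p0 w ->
  \sum_t step_prob scheduled_strategy p0 w t *
    ((upd A t k)%:~R + h (phase (size w)) k (tgt t) -
    h (phase (size w)) k (last_state p0 w) - g (phase (size w)) k) = 0.
Proof.
move=> pw; rewrite -[RHS](poisson_gh (phase (size w)) k (last_state p0 w)) [RHS]big_mkcond.
apply: eq_bigr => t _; rewrite (@step_prob_policy _ _ R (fun i => pol (phase i))
  (fun i => @pol_prob (phase i))) /=.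
by case: ifP => _ //; rewrite mul0r.
Qed.

(** Summing over the counters lets a single event control all of them. *)
Definition energy2 (w : hist) : R := \sum_k noise w k ^+ 2.

(** Expanding the square, the cross term has mean zero and each squared increment is at most
    [D ^+ 2]. *)
Lemma energy2_step w : is_path p0 w ->
  \sum_t step_prob scheduled_strategy p0 w t * energy2 (rcons w t) <=
  energy2 w + d%:R * D ^+ 2.
Proof.
move=> pw; rewrite /energy2; under eq_bigr do rewrite mulr_sumr.
rewrite exchange_big /= -[d in d%:R](card_ord d) mulr_natl -sumr_const -big_split /=.
apply: ler_sum => k _; under eq_bigr do rewrite noise_rcons.
set X := fun t => ((upd A t k)%:~R + h (phase (size w)) k (tgt t) -
    h (phase (size w)) k (last_state p0 w) - g (phase (size w)) k).
rewrite (eq_bigr (fun t => step_prob scheduled_strategy p0 w t * noise w k ^+ 2 +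
  2 * noise w k * (step_prob scheduled_strategy p0 w t * X t) +
  step_prob scheduled_strategy p0 w t * X t ^+ 2)); last by move=> t _; rewrite -/(X t); ring.
rewrite !big_split /= -mulr_suml (step_sum scheduled_is_strategy pw) mul1r -mulr_sumr.
rewrite (step_mean_increment k pw) mulr0 addr0 lerD2l.
apply: (@le_trans _ _ (\sum_t step_prob scheduled_strategy p0 w t * D ^+ 2)).
  apply: (step_mean_le scheduled_is_strategy) => // t _.
  rewrite -(real_normK (num_real (X t))) lerXn2r ?nnegrE //; last exact: increment_le.
  exact: le_trans (normr_ge0 _) (increment_le p0 k p0 t).
by rewrite -mulr_suml (step_sum scheduled_is_strategy pw) mul1r.
Qed.

(* Kolmogorov's inequality: [energy2], plus [d D^2] per remaining step, is a
   supermartingale. *)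
Lemma noise_bound (a : R) m : 0 < a ->
  \sum_(w : m.-tuple T) cyl_prob scheduled_strategy p0 [::] w *
    (hits (fun w => a ^+ 2 <= energy2 w) [::] w)%:R <= m%:R * (d%:R * D ^+ 2) / a ^+ 2.
Proof.
move=> a0; have a2 : 0 < a ^+ 2 by rewrite exprn_gt0.
have D0 : 0 <= d%:R * D ^+ 2 by rewrite mulr_ge0 // sqr_ge0.
have e0 w : 0 <= energy2 w by apply: sumr_ge0 => k _; exact: sqr_ge0.
pose Phi k w := (energy2 w + k%:R * (d%:R * D ^+ 2)) / a ^+ 2.
have -> : m%:R * (d%:R * D ^+ 2) / a ^+ 2 = Phi m [::].
  rewrite /Phi /energy2 big1 ?add0r // => k _.
  by rewrite /noise /correction !big_nil !big_ord0 subr0 addr0 expr0n.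
apply: (@ville_inequality _ _ _ scheduled_strategy p0 scheduled_is_strategy _ Phi) => //.
- by move=> k w _; rewrite divr_ge0 ?(ltW a2) // addr_ge0 // mulr_ge0.
- by move=> k w _ b; rewrite ler_pdivlMr // mul1r (le_trans b) // lerDl mulr_ge0.
- move=> k w pw _; rewrite /Phi.
  under eq_bigr do rewrite mulrA mulrDr.
  rewrite -mulr_suml ler_wpM2r ?invr_ge0 ?(ltW a2) // big_split /= -mulr_suml.
  rewrite (step_sum scheduled_is_strategy pw) mul1r -natr1.
  by have := energy2_step pw; lra.
Qed.

Lemma vec_after_noise n (w : hist) k : (vec_after (vconst n) w k)%:~R =
  n%:R + noise w k - correction w k + \sum_(j < size w) g (phase j) k.
Proof. by rewrite /vec_after /noise intrD /vconst -pmulrn; ring. Qed.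

(** While the noise stays below [a], the initial value [n] pays for noise, potentials and the worst
    drift of an incomplete round, so no counter becomes negative; after [k] full rounds the drift of
    [c] alone reaches [K]. *)
Lemma scheduled_prob_ge (n k : nat) (a K : R) : 0 < a ->
  a + H * (2 * (k * W)%:R + 2) + (W * L)%:R * G <= n%:R ->
  K <= L%:R * (k%:R * \sum_(r <- lst) g r c) ->
  1 - (k * W * L)%:R * (d%:R * D ^+ 2) / a ^+ 2 <=
    prob_Cge scheduled_strategy p0 (vconst n) c K.
Proof.
move=> a0 hn hK; pose m := (k * W * L)%N.
have H0 : 0 <= H by exact: le_trans (normr_ge0 _) (h_le p0 c p0).
have G0 : 0 <= G by exact: le_trans (normr_ge0 _) (g_le p0 c).
apply: le_trans _ (prob_within_le_Cge p0 scheduled_is_strategy (vconst n) c K m).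
apply: (prob_within_ge scheduled_is_strategy _ (noise_bound m a0)).
move=> w nh.
have small i k' : (i <= m)%N -> `|noise (take i w) k'| <= a.
  move=> im; have : ~~ (a ^+ 2 <= energy2 (take i w)).
    by apply: contra nh => b; apply/hitsP; exists i; rewrite ?size_tuple.
  rewrite -ltNge => /ltW le; rewrite -(@ler_pXn2r _ 2) ?nnegrE ?(ltW a0) //.
  rewrite real_normK ?num_real // (le_trans _ le) // /energy2 (bigD1 k') //= lerDl.
  by apply: sumr_ge0 => ? _; exact: sqr_ge0.
(* At most [k * W] blocks are complete by step [i], which bounds the correction; [W * L * G] is left
   in reserve for the drift. *)
have base i k' : (i <= m)%N -> (W * L)%:R * G <=
    n%:R + noise (take i w) k' - correction (take i w) k'.
  move=> im; have := small i k' im; have := correction_le (take i w) k'.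
  rewrite size_takel ?size_tuple // => hc hs.
  have : H * (2 * (i %/ L)%:R + 2) <= H * (2 * (k * W)%:R + 2).
    rewrite ler_wpM2l // lerD2r ler_wpM2l // ler_nat.
    by rewrite -(mulnK (k * W) L_gt0) leq_div2r.
  have /ler_normlP[_ h1] := hc; have /ler_normlP[h2 _] := hs.
  lra.
apply/witnessP; exists m; split=> //.
  apply/aliveP => j; rewrite size_takel ?size_tuple // => jm.
  rewrite take_takel //; apply/forallP => k'.
  rewrite -(ler0z R) vec_after_noise.
  have := base j k' jm.
  have := @schedule_sum_ge R Q p0 lst L L_gt0 lst_gt0 (g^~ k') G
    (size (take j w)) (fun r => g_le r k') (lst_gain k').
  lra.
rewrite vec_after_noise; apply: le_trans hK _.
rewrite size_takel ?size_tuple // (sum_blocks p0 lst L_gt0 (g^~ c))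
  (sum_rounds p0 lst (g^~ c)).
rewrite lerDr; apply: le_trans (base m c (leqnn m)).
by rewrite mulr_ge0.
Qed.

End ScheduledWalk.

(** * The lower estimates *)

(* With [rho = n ^ - delta], the block length is about [n rho]: blocks and their
   boundaries cost [O(n rho)], the gain is of order [n^2 rho^2], and the target is
   at most [n^2 rho^4]. *)
Lemma block_length_asymptotics (R : realType) (W : nat) (H G E gam eps eta : R) :
  0 <= H -> 0 <= G -> 0 <= E -> 0 < gam -> 0 < eps -> 0 < eta ->
  exists N, forall n, (N <= n)%N ->
  let L := Num.truncn (n%:R `^ (1 - Num.min eps 1 / 2) : R) in
  [/\ (0 < n)%N, (0 < L)%N,
      n%:R / 4 + H * (2 * (L * W)%:R + 2) + (W * L)%:R * G <= n%:R,
      (n ^ 2)%:R `^ (1 - eps) <= L%:R * (L%:R * gam)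
    & (L * W * L)%:R * E / (n%:R / 4) ^+ 2 <= eta].
Proof.
(* This choice gives both [delta < 1] and [2 * delta <= eps]. *)
move=> H0 G0 E0 gam0 eps0 eta0; set delta := Num.min eps 1 / 2.
have d0 : 0 < delta by rewrite divr_gt0 // lt_min eps0 ltr01.
have d1 : 0 < 1 - delta.
  have : Num.min eps 1 <= 1 by rewrite ge_min lexx orbT.
  by rewrite /delta; lra.
have deps : 2 * delta <= eps.
  have : Num.min eps 1 <= eps by rewrite ge_min lexx.
  by rewrite /delta; lra.
(* One constant per requirement: gain above the target, block costs at most [n / 2], failure
   probability at most [eta]. Once [rho <= B^-1] with [B] above all three, every requirement
   follows. *)
pose B1 := 4 / gam; pose B2 := 2 * (H * (2 * W%:R + 2) + W%:R * G).
pose B3 := 16 * W%:R * E / eta.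
have B10 : 0 <= B1 by rewrite divr_ge0 // ltW.
have B20 : 0 <= B2 by rewrite mulr_ge0 // addr_ge0 // mulr_ge0 // addr_ge0 // mulr_ge0.
have B30 : 0 <= B3 by rewrite divr_ge0 ?(ltW eta0) // !mulr_ge0.
pose B := 1 + B1 + B2 + B3.
have B0 : 0 < B by rewrite /B; lra.
have Bi0 : 0 < B^-1 by rewrite invr_gt0.
have [N1 hN1] := powR_nat_small d0 Bi0.
have half0 : 0 < 2^-1 :> R by rewrite invr_gt0.
have [N2 hN2] := powR_nat_small d1 half0.
exists (maxn 1 (maxn N1 N2)) => n; rewrite !geq_max => /and3P[n0 /hN1 h1 /hN2 h2] L.
have nR : 1 <= n%:R :> R by rewrite ler1n.
have nR0 : 0 < n%:R :> R by exact: lt_le_trans nR.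
pose x : R := n%:R; pose rho := x `^ (- delta).
have rho0 : 0 < rho by rewrite powR_gt0.
have rhoB : rho * B <= 1 by rewrite -ler_pdivlMr // div1r.
have s_eq : x `^ (1 - delta) = x * rho.
  by rewrite powRD ?powRr1 ?(ltW nR0) //; apply/implyP => _; rewrite gt_eqF.
(* From this on, truncation loses at most half: [L >= x * rho / 2]. *)
have s2 : 2 <= x * rho.
  rewrite -s_eq -[2]invrK -[leRHS]invrK lef_pV2 ?posrE ?invr_gt0 ?powR_gt0 //.
  by rewrite -powRN.
have [Ls sL] : (L%:R <= x * rho) /\ (x * rho < L%:R + 1).
  have := @truncn_itv R (x `^ (1 - delta)) (powR_ge0 _ _).
  by rewrite -/L -s_eq natr1 => /andP.
have L1 : 1 < L%:R + 0 :> R by lra.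
have rb (b : R) : 0 <= b -> b <= B -> rho * b <= 1.
  by move=> b0 bB; apply: le_trans rhoB; rewrite ler_pM2l.
have r1 : rho <= 1 by rewrite -[rho]mulr1 rb // /B; lra.
have rB1 : rho <= gam / 4.
  have : rho * B1 <= 1 by apply: rb => //; rewrite /B; lra.
  by rewrite /B1 mulrA ler_pdivrMr //; lra.
have rB2 : rho * B2 <= 1 by apply: rb => //; rewrite /B; lra.
have rB3 : rho * (16 * W%:R * E) <= eta.
  have : rho * B3 <= 1 by apply: rb => //; rewrite /B; lra.
  by rewrite /B3 mulrA ler_pdivrMr // mul1r.
split.
- by [].
- by rewrite -(ltr0n R); lra.
- rewrite !natrM -/x.
  have : x * (rho * B2) <= x by rewrite ger_pMr.
  have : H * (2 * (L%:R * W%:R) + 2) <= H * ((2 * W%:R + 2) * (x * rho)).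
    rewrite ler_wpM2l // [leRHS]mulrDl lerD //; last by lra.
    by have := ler_wpM2l (ler0n R W) Ls; lra.
  have : W%:R * L%:R * G <= W%:R * (x * rho) * G by rewrite ler_wpM2r // ler_wpM2l.
  rewrite /B2; lra.
(* The exponents compare as [2 - 2 * eps <= 2 - 4 * delta]. Two of the four factors [rho] belong to
   the gain, the other two are absorbed by [gam / 4]. *)
- apply: (@le_trans _ _ (x ^+ 2 * rho ^+ 4)).
    rewrite natrX -/x -powR_mulrn ?(ltW nR0) // -powRrM.
    rewrite -[rho ^+ 4]powR_mulrn ?(ltW rho0) // /rho -powRrM -powRD.
      by apply: ler_powR => //; lra.
    by apply/implyP => _; rewrite gt_eqF.
  apply: (@le_trans _ _ ((x * rho / 2) ^+ 2 * gam)); last first.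
    by rewrite mulrA ler_wpM2r ?(ltW gam0) // -expr2 lerXn2r ?nnegrE; lra.
  have -> : x ^+ 2 * rho ^+ 4 = (x * rho) ^+ 2 * rho ^+ 2 by ring.
  have -> : (x * rho / 2) ^+ 2 * gam = (x * rho) ^+ 2 * (gam / 4) by field.
  by rewrite ler_wpM2l ?sqr_ge0 // (le_trans _ rB1) // expr2 ger_pMr.
- rewrite !natrM ler_pdivrMr; last by rewrite exprn_gt0 // divr_gt0.
  apply: (@le_trans _ _ ((x * rho) ^+ 2 * (W%:R * E))).
    rewrite mulrA ler_wpM2r // mulrAC ler_wpM2r // -expr2 lerXn2r ?nnegrE //; lra.
  have -> : (x * rho) ^+ 2 * (W%:R * E) =
    (x / 4) ^+ 2 * (rho * (rho * (16 * W%:R * E))) by field.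
  by rewrite -/x mulrC ler_wpM2r ?sqr_ge0 // (le_trans _ rB3) // ler_piMl // !mulr_ge0 // ltW.
Qed.

Lemma sum_flatten_nseq (V : zmodType) (I : finType) (X : I -> nat) (F : I -> V) :
  \sum_(r <- flatten [seq nseq (X r) r | r <- enum I]) F r = \sum_r F r *+ X r.
Proof.
rewrite big_flatten big_map big_enum; apply: eq_bigr => r _.
by rewrite big_nseq iter_addr_0.
Qed.

Lemma norm_le_sum (R : realDomainType) (I : finType) (f : I -> R) i :
  `|f i| <= \sum_j `|f j|.
Proof. by rewrite (bigD1 i) //= lerDl sumr_ge0. Qed.

Section Lower.
Variables (R : realType) (d : nat) (A : VMDP d).
Local Notation Q := (state A).
Local Notation T := (trans A).
Hypothesis A_connected : strongly_connected A.

(** A state is listed with multiplicity proportional to its outflow, made integral by a common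
    denominator [N]; by [total_gain] the gains over the list then add up to [N] times the effect of
    the circulation. *)
Lemma policy_list (c : 'I_d) : (forall y z, @solII d A y z -> y c <= 0) ->
  exists (pol : Q -> T -> rat) (g : Q -> 'I_d -> rat) (h : Q -> 'I_d -> Q -> rat)
    (lst : seq Q),
  [/\ forall r t, 0 <= pol r t,
      forall r p, \sum_(t | src A t == p) pol r t = 1 &
      forall r t, is_prob A (src A t) -> pol r t = prob A t] /\
  [/\ forall r k p, \sum_(t | src A t == p)
        pol r t * ((upd A t k)%:~R + h r k (tgt A t) - h r k p) = g r k,
      forall k, 0 <= \sum_(r <- lst) g r k & 0 < \sum_(r <- lst) g r c].
Proof.
move=> /circulation_exists [x [x0 x_flow x_prob x_eff x_effc]].
have /choice [gh ghP] (rk : Q * 'I_d) : exists gh : rat * (Q -> rat),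
    forall p, \sum_(t | src A t == p) component_policy x rk.1 t *
      ((upd A t rk.2)%:~R + gh.2 (tgt A t) - gh.2 p) = gh.1.
  have [g [h hh]] := poisson (component_policy_ge0 x0 rk.1) (component_policy_sum x rk.1)
    (component_policy_to A_connected x0 x_flow rk.1) (fun t => (upd A t rk.2)%:~R).
  by exists (g, h).
pose g r k := (gh (r, k)).1; pose h r k := (gh (r, k)).2.
have [N N0 [a ha]] := common_denominator (outflow x).
pose lst := flatten [seq nseq `|a r|%N r | r <- enum Q].
have lstE k : \sum_(r <- lst) g r k = N%:R * \sum_t x t * (upd A t k)%:~R.
  rewrite -(total_gain x0 x_flow (g := g^~ k) (f := fun t => (upd A t k)%:~R)
    (h := fun r => h r k) (fun r => ghP (r, k))).
  rewrite /lst sum_flatten_nseq mulr_sumr; apply: eq_bigr => r _.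
  rewrite mulrA ha -mulr_natl; congr (_ * _).
  rewrite pmulrn gez0_abs // -(ler0z rat) -ha mulr_ge0 ?outflow_ge0 //.
exists (component_policy x), g, h, lst; split; split.
- exact: component_policy_ge0.
- exact: component_policy_sum.
- exact: component_policy_prob.
- by move=> r k; exact: ghP (r, k).
- by move=> k; rewrite lstE mulr_ge0.
- by rewrite lstE mulr_gt0 // ltr0n.
Qed.

(** The data are moved to [R], bounded by finite sums of absolute values, and run for [L n] rounds
    of blocks of length [L n] with noise threshold [n / 4]. *)
Lemma lower_estimate_quadratic (c : 'I_d) :
  (forall y z, @solII d A y z -> y c <= 0) ->
  lower_estimate A R c (fun n => (n ^ 2)%N).
Proof.
move=> /policy_list [pol [g [h [lst [[pol0 pol1 polp] [gh lst0 lstc]]]]]] eps eps0.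
have [p0 _] := @state_nonempty d A.
pose gR r k : R := ratr (g r k); pose hR r k p : R := ratr (h r k p).
pose incr r k p t : R := (upd A t k)%:~R + hR r k (tgt A t) - hR r k p - gR r k.
have ghR r k p : \sum_(t | src A t == p) ratr (pol r t) * incr r k p t = 0.
  transitivity (ratr (\sum_(t | src A t == p) pol r t *
     ((upd A t k)%:~R + h r k (tgt A t) - h r k p) -
     (\sum_(t | src A t == p) pol r t) * g r k) : R).
    rewrite mulr_suml -sumrB rmorph_sum; apply: eq_bigr => t _ /=.
    by rewrite -mulrBr rmorphM /= 2!rmorphB rmorphD /= ratr_int.
  by rewrite gh pol1 mul1r subrr rmorph0.
pose H := \sum_(i : Q * 'I_d * Q) `|hR i.1.1 i.1.2 i.2|.
pose G := \sum_(i : Q * 'I_d) `|gR i.1 i.2|.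
pose D := \sum_(i : Q * 'I_d * Q * T) `|incr i.1.1.1 i.1.1.2 i.1.2 i.2|.
have h_le r k p : `|hR r k p| <= H.
  exact: (@norm_le_sum _ _ (fun i : Q * 'I_d * Q => hR i.1.1 i.1.2 i.2) (r, k, p)).
have g_le r k : `|gR r k| <= G.
  exact: (@norm_le_sum _ _ (fun i : Q * 'I_d => gR i.1 i.2) (r, k)).
have incr_le r k p t : `|incr r k p t| <= D.
  exact: (@norm_le_sum _ _ (fun i : Q * 'I_d * Q * T => incr i.1.1.1 i.1.1.2 i.1.2 i.2)
    (r, k, p, t)).
have lstR k : \sum_(r <- lst) gR r k = ratr (\sum_(r <- lst) g r k) by rewrite rmorph_sum.
have lst0R k : 0 <= \sum_(r <- lst) gR r k by rewrite lstR ler0q.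
have lstcR : 0 < \sum_(r <- lst) gR r c by rewrite lstR ltr0q.
pose L n := Num.truncn (n%:R `^ (1 - Num.min eps 1 / 2) : R).
have strat n := scheduled_is_strategy R pol0 pol1 lst p0 (L n).
exists p0, (fun n => scheduled_strategy R pol lst p0 (L n)); split=> //.
apply: limn_inf_eq1 => [n|eta eta0]; first exact: prob_Cge_le1.
have H0 : 0 <= H by exact: sumr_ge0.
have G0 : 0 <= G by exact: sumr_ge0.
have E0 : 0 <= d%:R * D ^+ 2 by rewrite mulr_ge0 // sqr_ge0.
have [N hN] := block_length_asymptotics (size lst) H0 G0 E0 lstcR eps0 eta0.
exists N => n /hN [n0 L0 hb hK hE].
have a0 : 0 < n%:R / 4 :> R by rewrite divr_gt0 // ltr0n.
have := scheduled_prob_ge pol0 pol1 polp ghR h_le g_le incr_le lst0R lstcR p0 L0 a0 hb hK.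
by apply: le_trans; rewrite lerD2l lerN2.
Qed.

(** The initial configuration is already a witness at horizon zero, since [n ^ (1 - eps) <= n] for
    [n >= 1]; any strategy serves. *)
Lemma lower_estimate_linear (c : 'I_d) : lower_estimate A R c id.
Proof.
move=> eps eps0; have [p0 _] := @state_nonempty d A.
pose sigma := policy_strategy R (fun _ => fallback (A := A)).
have hs : is_strategy sigma.
  apply: is_strategy_policy => [_ t|_ p]; [exact: ltW (fallback_gt0 t) | exact: fallback_sum].
exists p0, (fun=> sigma); split=> //.
apply: limn_inf_eq1 => [n|eta eta0]; first exact: prob_Cge_le1.
exists 1%N => n n0; apply: (@le_trans _ _ 1); first by rewrite gerBl ltW.
apply: le_trans _ (prob_within_le_Cge p0 hs _ _ _ 0).
rewrite /prob_within (eq_bigr (fun w : 0.-tuple T => cyl_prob sigma p0 [::] w))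
  ?cyl_sum // => w _.
suff -> : witness (vconst n) c (n%:R `^ (1 - eps) : R) w by rewrite mulr1.
apply/witnessP; exists 0%N; rewrite take0; split=> //.
  apply/aliveP => j _; rewrite /=; apply/forallP => k.
  by rewrite /vec_after big_nil addr0.
rewrite /vec_after big_nil addr0 /vconst -pmulrn.
by apply: ler1_powR; rewrite ?ler1n // gerBl ltW.
Qed.

End Lower.

Theorem theorem4p3 (R : realType) (d : nat) (hd : (0 < d)%N) (A : VMDP d)
  (hsc : strongly_connected A)
  (y : 'I_d -> int) (z : state A -> int) (hmax : maximal_solII y z)
  (c : 'I_d) :
  (0 < y c -> tight_estimate A R c (fun n => n)) /\
  (y c = 0 -> lower_estimate A R c (fun n => (n ^ 2)%N)).
Proof.
have [sol [ymax _]] := hmax; split=> [yc|yc0].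
  split; first exact: lower_estimate_linear.
  exact: upper_estimate_linear sol yc.
(* A solution positive at [c] would, by maximality, make [y c] positive. *)
apply: lower_estimate_quadratic => // y' z' sol'; rewrite leNgt; apply/negP => yc'.
by have := ymax c (ex_intro _ y' (ex_intro _ z' (conj sol' yc'))); rewrite yc0 ltxx.
Qed.
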